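(* Let $P$ be a minuscule poset, arising from a minuscule representation of a complex simple Lie algebra with Weyl group $W$ and set of Coxeter generators $S=\{s_1,\ldots,s_n\}$, and labeled by elements of $S$ via the minuscule heap. For any ordering $(s_{i_1},\ldots,s_{i_n})$ of $S$, the Fon-Der-Flaass action $\Psi$ on $J(P)$ and the toggle group element $t_{(i_1,\ldots,i_n)}$ are conjugate in the toggle group $G(P)$.
   Context: Posets and toggles: for a finite poset $P$, $J(P)$ is the set of order ideals (down-closed subsets). The Fon-Der-Flaass action $\Psi:J(P)\to J(P)$ sends $I$ to the unique order ideal whose set of maximal elements is the set of minimal elements of $P\setminus I$. For $p\in P$, the toggle $t_p:J(P)\to J(P)$ sends $I$ to the symmetric difference $I\,\Delta\,\{p\}$ if this is an order ideal, and to $I$ otherwise. The toggle group is $G(P)=\langle t_p\rangle_{p\in P}$, a group of permutations of $J(P)$ (it contains $\Psi$). Minuscule posets: let $\mathfrak{g}$ be a complex simple Lie algebra with a fixed Cartan subalgebra, simple roots $\alpha_1,\ldots,\alpha_n$, simple reflections $S=\{s_1,\ldots,s_n\}$, Weyl group $W=\langle S\rangle$ with length function $l$, and weight lattice $\Lambda$. The root order on $\Lambda$ is the transitive closure of the relations $\mu<\omega$ whenever $\omega-\mu$ is a simple root. A nontrivial irreducible finite-dimensional representation $V$ is minuscule if $W$ acts transitively on its set $\Lambda_V$ of weights; its highest weight $\lambda$ is its minuscule weight. The weight poset $Q_V$ is the restriction of the root order to $\Lambda_V$ (a distributive lattice when $V$ is minuscule), and the minuscule poset $P_V$ is the poset of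 join-irreducible elements of $Q_V$, so $J(P_V)\cong Q_V$. A minuscule poset is one of the form $P_V$. Heap labeling: let $V$ be a minuscule representation of $\mathfrak{g}$ with minuscule weight (highest weight) $\lambda$ and minuscule poset $P=P_V$, and let $J=\{i: s_i\lambda=\lambda\}$, $W_J=\langle s_i\rangle_{i\in J}$ (the stabilizer of $\lambda$), and let $W^J\subseteq W$ be the set of minimum-length representatives of the cosets in $W/W_J$; let $w_0^J$ be the longest element of $W^J$. The element $w_0^J$ is fully commutative, i.e. all its reduced words are related by exchanges of adjacent commuting generators. Given a reduced word $s_{a_1}s_{a_2}\cdots s_{a_\ell}$ for $w_0^J$, the minuscule heap $P_{w_0^J}$ is the set $\{1,\ldots,\ell\}$ partially ordered by the transitive closure of the relations $j>j'$ for all integers $j<j'$ such that $s_{a_j}$ and $s_{a_{j'}}$ do not commute; the element $j$ is labeled by $s_{a_j}$. Up to label-preserving isomorphism it does not depend on the reduced word. As posets, $P_{w_0^J}\cong P_V$, and each element of $P=P_V$ is labeled by the label of the corresponding element of $P_{w_0^J}$. Toggle sequence: for $1\le k\le n$, let $t'_k=\prod t_p$, the product over all $p\in P$ labeled by $s_k$ (these toggles commute). For an ordering $(s_{i_1},\ldots,s_{i_n})$ of $S$, set $t_{(i_1,\ldots,i_n)}=t'_{i_1}t'_{i_2}\cdots t'_{i_n}$, composed right to left (first toggle at all elements labeled $s_{i_n}$, and so on, finally at all elements labeled $s_{i_1}$). *)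

(* Defs.v *)
From Stdlib Require Import Relation_Operators.
From HB Require Import structures.
From mathcomp Require Import all_boot all_order all_algebra all_fingroup.
From mathcomp Require Import boolp reals.
From mathcomp.real_closed Require Import complex.

Set Implicit Arguments.
Unset Strict Implicit.
Unset Printing Implicit Defensive.

Import Order.TTheory GRing.Theory.

Section OrderIdeals.
Context {disp : Order.disp_t} {P : finPOrderType disp}.
Implicit Types (A : {set P}) (p q : P).
Local Open Scope order_scope.

Definition down_closed A : bool :=
  [forall p, forall q, (q \in A) ==> (p <= q) ==> (p \in A)].

Lemma down_closedP A :
  reflect (forall p q, q \in A -> p <= q -> p \in A) (down_closed A).
Proof.
apply: (iffP forallP) => [dA p q qA pq | dA p].
  by have /forallP/(_ q) := dA p; rewrite qA pq.
by apply/forallP => q; apply/implyP => qA; apply/implyP; apply: dA.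
Qed.

Definition maximals A : {set P} := [set p in A | [forall q in A, ~~ (p < q)]].
Definition minimals A : {set P} := [set p in A | [forall q in A, ~~ (q < p)]].
Definition down_closure A : {set P} := [set p | [exists q in A, p <= q]].

Lemma down_closure_closed A : down_closed (down_closure A).
Proof.
apply/down_closedP => p q; rewrite !inE => /exists_inP[r rA qr] pq.
by apply/exists_inP; exists r => //; apply: le_trans pq qr.
Qed.

Lemma above_minimal A p : p \in A -> exists2 q, q \in minimals A & q <= p.
Proof.
move=> pA; pose B q := (q \in A) && (q <= p).
have pB : B p by rewrite /B pA lexx.
case: (arg_minnP (fun q => #|[set r | r < q]|) pB) => q.
move=> /andP[qA qp] qmin; exists q => //; rewrite !inE qA /=.
apply/forall_inP => r rA; apply/negP => rq.
have /qmin : B r by rewrite /B rA (le_trans (ltW rq)).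
rewrite leqNgt => /negP; apply; apply/proper_card/properP.
split; first by apply/subsetP => x; rewrite !inE => /lt_trans; apply.
by exists r; rewrite !inE ?rq ?ltxx.
Qed.

Lemma below_maximal A p : p \in A -> exists2 q, q \in maximals A & p <= q.
Proof.
move=> pA; pose B q := (q \in A) && (p <= q).
have pB : B p by rewrite /B pA lexx.
case: (arg_minnP (fun q => #|[set r | q < r]|) pB) => q.
move=> /andP[qA qp] qmin; exists q => //; rewrite !inE qA /=.
apply/forall_inP => r rA; apply/negP => rq.
have /qmin : B r by rewrite /B rA (le_trans qp (ltW rq)).
rewrite leqNgt => /negP; apply; apply/proper_card/properP.
split; first by apply/subsetP => x; rewrite !inE; apply: lt_trans.
by exists r; rewrite !inE ?rq ?ltxx.
Qed.

Lemma maximals_down_closure_minimals A :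
  maximals (down_closure (minimals A)) = minimals A.
Proof.
apply/setP => p; apply/idP/idP.
  rewrite inE => /andP[]; rewrite inE => /exists_inP[q qm pq] /forall_inP pmax.
  have /pmax : q \in down_closure (minimals A).
    by rewrite inE; apply/exists_inP; exists q.
  by rewrite lt_neqAle pq andbT negbK => /eqP->.
move=> pm; rewrite inE; apply/andP; split.
  by rewrite inE; apply/exists_inP; exists p.
apply/forall_inP => q; rewrite inE => /exists_inP[r rm qr]; apply/negP => pq.
have pr : p < r := lt_le_trans pq qr.
move: rm pm; rewrite !inE => /andP[_ /forall_inP rmin] /andP[pA _].
by have := rmin p pA; rewrite pr.
Qed.

Lemma down_closed_eq A B :
  down_closed A -> down_closed B -> maximals A = maximals B -> A = B.
Proof.
move=> + + eqm.
have sub C D : down_closed D -> maximals C = maximals D -> C \subset D.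
  move=> /down_closedP dD eqCD; apply/subsetP => p /below_maximal[q].
  by rewrite eqCD inE => /andP[qD _]; apply: dD.
by move=> dA dB; apply/eqP; rewrite eqEsubset !sub.
Qed.

Lemma down_closed_eqC A B :
  down_closed A -> down_closed B -> minimals (~: A) = minimals (~: B) -> A = B.
Proof.
have sub C D : down_closed C -> minimals (~: C) = minimals (~: D) -> C \subset D.
  move=> /down_closedP dC eqCD; apply/subsetP => p pC; apply/negPn/negP => pD.
  have /above_minimal[q] : p \in ~: D by rewrite inE.
  rewrite -eqCD !inE => /andP[/negP qC _] qp; exact/qC/(dC _ p).
by move=> dA dB eqm; apply/eqP; rewrite eqEsubset !sub.
Qed.

End OrderIdeals.

(* [ideals P] is J(P). *)
Record ideals (disp : Order.disp_t) (P : finPOrderType disp) := Ideal {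
  ideal_set :> {set P};
  ideal_closed : down_closed ideal_set
}.

HB.instance Definition _ disp (P : finPOrderType disp) :=
  [isSub for @ideal_set disp P].
HB.instance Definition _ disp (P : finPOrderType disp) :=
  [Finite of ideals P by <:].

Section ToggleGroup.
Context {disp : Order.disp_t} {P : finPOrderType disp}.
Implicit Types (I : ideals P) (p : P).

Definition toggle_set p (A : {set P}) : {set P} :=
  (A :\: [set p]) :|: ([set p] :\: A).

(* [insubd I A] is [A] seen in J(P) if [A] is down-closed, and [I] otherwise. *)
Definition toggle_fun p I : ideals P := insubd I (toggle_set p I).

Lemma toggle_setK p : involutive (toggle_set p).
Proof.
by move=> A; apply/setP => q; rewrite !inE; case: (q == p); case: (q \in A).
Qed.

Lemma toggle_funK p : involutive (toggle_fun p).
Proof.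
move=> I; apply: val_inj; rewrite /toggle_fun.
have [dA | /negbTE ndA] := boolP (down_closed (toggle_set p I)).
  have eqJ : val (insubd I (toggle_set p I)) = toggle_set p I.
    by rewrite val_insubd dA.
  by rewrite val_insubd [ideal_set _]eqJ toggle_setK ideal_closed.
have -> : insubd I (toggle_set p I) = I.
  by apply: val_inj; rewrite val_insubd ndA.
by rewrite val_insubd ndA.
Qed.

Definition toggle p : {perm ideals P} := perm (inv_inj (toggle_funK p)).

Definition fdf_fun I : ideals P :=
  Ideal (down_closure_closed (minimals (~: (I : {set P})))).

Lemma maximals_fdf_fun I : maximals (fdf_fun I) = minimals (~: (I : {set P})).
Proof. exact: maximals_down_closure_minimals. Qed.

Lemma fdf_fun_unique I (K : ideals P) :
  maximals K = minimals (~: (I : {set P})) -> K = fdf_fun I.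
Proof.
by rewrite -maximals_fdf_fun => eqm; apply/val_inj/down_closed_eq => //;
   apply: ideal_closed.
Qed.

Lemma fdf_fun_inj : injective fdf_fun.
Proof.
move=> I K eqIK; apply/val_inj/down_closed_eqC; try exact: ideal_closed.
by rewrite -!maximals_fdf_fun eqIK.
Qed.

Definition fon_der_flaass : {perm ideals P} := perm fdf_fun_inj.

End ToggleGroup.

Definition toggle_group (disp : Order.disp_t) (P : finPOrderType disp) :
  {group {perm ideals P}} := <<[set toggle p | p : P]>>%G.

Section ToggleSequence.
Context {disp : Order.disp_t} {P : finPOrderType disp} {n : nat}.
Variables (label : P -> 'I_n) (sigma : 'S_n).
Local Open Scope group_scope.

(* The factors commute when [label] is a minuscule heap labeling, so the order
   in which the big operator takes them is then irrelevant. *)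
Definition label_toggle (k : 'I_n) : {perm ideals P} :=
  \prod_(p | label p == k) toggle p.

(* The ordering of the generators is (sigma 0, ..., sigma (n-1)).  A product of
   permutations in MathComp applies its left factor first, hence [rev_ord]. *)
Definition toggle_sequence : {perm ideals P} :=
  \prod_(k < n) label_toggle (sigma (rev_ord k)).

End ToggleSequence.

Local Open Scope ring_scope.

Record lieAlgebra (F : fieldType) := LieAlgebra {
  lie_sort :> vectType F;
  lie_bracket : lie_sort -> lie_sort -> lie_sort;
  lie_linearl : forall y, linear (lie_bracket^~ y);
  lie_linearr : forall x, linear (lie_bracket x);
  lie_alternating : forall x, lie_bracket x x = 0;
  lie_jacobi : forall x y z,
    lie_bracket x (lie_bracket y z) + lie_bracket y (lie_bracket z x)
      + lie_bracket z (lie_bracket x y) = 0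
}.

Record lieModule (F : fieldType) (g : lieAlgebra F) := LieModule {
  mod_sort :> vectType F;
  mod_act : g -> mod_sort -> mod_sort;
  mod_linearl : forall v, linear (mod_act^~ v);
  mod_linearr : forall x, linear (mod_act x);
  mod_bracket : forall x y v,
    mod_act (lie_bracket x y) v = mod_act x (mod_act y v) - mod_act y (mod_act x v)
}.

Section LieAlgebras.
Context {F : fieldType} {g : lieAlgebra F}.
Implicit Types (U h : {vspace g}) (V : lieModule g).

Definition bracket_space U1 U2 : {vspace g} :=
  <<[seq lie_bracket x y | x <- vbasis U1, y <- vbasis U2]>>%VS.

Definition lie_ideal U : Prop := (bracket_space fullv U <= U)%VS.

Definition lie_nilpotent U : Prop := exists k, iter k (bracket_space U) U = 0%VS.

Definition cartan_subalgebra h : Prop :=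
  [/\ (bracket_space h h <= h)%VS,
      lie_nilpotent h &
      forall x : g, (forall y, y \in h -> lie_bracket x y \in h) -> x \in h].

Definition submodule V (U : {vspace V}) : Prop :=
  forall (x : g) (v : V), v \in U -> mod_act x v \in U.

Definition irreducible_module V : Prop :=
  fullv != 0%VS :> {vspace V} /\
  forall U : {vspace V}, submodule U -> U = 0%VS \/ U = fullv.

Definition nontrivial_module V : Prop :=
  exists (x : g) (v : V), mod_act x v != 0.

End LieAlgebras.

Definition simple_lie (F : fieldType) (g : lieAlgebra F) : Prop :=
  bracket_space fullv fullv != 0%VS :> {vspace g} /\
  forall U : {vspace g}, lie_ideal U -> U = 0%VS \/ U = fullv.

Notation cartan_dual h := 'Hom(subvs_of h, _^o).

Section Weights.
Context {F : fieldType} {g : lieAlgebra F}.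
Variable h : {vspace g}.
Implicit Types (mu : cartan_dual h).

Definition root_vector mu (y : g) : Prop :=
  forall x : subvs_of h, lie_bracket (vsval x) y = mu x *: y.

Definition is_root mu : Prop := mu != 0 /\ exists2 y, y != 0 & root_vector mu y.

Definition is_weight (V : lieModule g) mu : Prop :=
  exists2 v : V, v != 0 &
    forall x : subvs_of h, mod_act (vsval x) v = mu x *: v.

End Weights.

(* A choice of simple roots alpha_i, together with their coroots: the coroot of
   alpha_i is the element c of [g_(alpha_i), g_(-alpha_i)], a line, such that
   alpha_i(c) = 2. *)
Record simpleRoots (F : fieldType) (g : lieAlgebra F) (h : {vspace g}) (n : nat) :=
  SimpleRoots {
    simple_root : 'I_n -> cartan_dual h;
    simple_coroot : 'I_n -> subvs_of h;
    simple_root_is_root : forall i, is_root (simple_root i);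
    simple_root_basis : basis_of fullv [tuple simple_root i | i < n];
    simple_root_sign : forall beta, is_root beta ->
      exists k : 'I_n -> nat,
        beta = \sum_i simple_root i *+ k i \/ beta = - \sum_i simple_root i *+ k i;
    simple_corootP : forall i, exists e f : g,
      [/\ root_vector (simple_root i) e, root_vector (- simple_root i) f &
          vsval (simple_coroot i) = lie_bracket e f];
    simple_coroot2 : forall i, simple_root i (simple_coroot i) = 2%:R
  }.

Section WeylGroup.
Context {F : fieldType} {g : lieAlgebra F} {h : {vspace g}} {n : nat}.
Variable D : simpleRoots h n.
Local Notation hd := (cartan_dual h).
Implicit Types (mu nu : hd) (w u : 'End(hd)) (a : seq 'I_n) (J : pred 'I_n).

Definition reflection_fun (i : 'I_n) mu : hd :=
  mu - (mu (simple_coroot D i) : F) *: simple_root D i.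

Definition simple_reflection (i : 'I_n) : 'End(hd) := linfun (reflection_fun i).

Lemma reflection_fun_linear i : linear (reflection_fun i).
Proof.
move=> c mu nu; rewrite /reflection_fun !lfunE /= !lfunE /=.
rewrite scalerDl scalerBr opprD !addrA scalerA.
by congr (_ - _); apply: addrAC.
Qed.

Lemma simple_reflectionE i mu : simple_reflection i mu = reflection_fun i mu.
Proof.
pose f := GRing.isLinear.Build _ _ _ _ _ (reflection_fun_linear i).
pose L : {linear hd -> hd} := HB.pack (reflection_fun i) f.
exact: (lfunE L).
Qed.

Definition word_prod a : 'End(hd) :=
  foldr (fun i w => (simple_reflection i \o w)%VF) \1%VF a.

(* [parabolic J] is W_J, and [parabolic predT] is the Weyl group W. *)
Definition parabolic J w : Prop := exists2 a, all J a & word_prod a = w.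

Definition has_word w (k : nat) : bool :=
  [exists a : k.-tuple 'I_n, word_prod a == w].

(* The length function l on W; it takes the value 0 outside of W. *)
Definition weyl_length w : nat :=
  if pselect (exists k, has_word w k) is left wW then ex_minn wW else 0%N.

Definition reduced_word w a : Prop := word_prod a = w /\ size a = weyl_length w.

Definition stabilizer_set mu : pred 'I_n := fun i => simple_reflection i mu == mu.

Definition min_coset_rep J w : Prop :=
  parabolic predT w /\
  forall u, parabolic J u -> (weyl_length w <= weyl_length (w \o u)%VF)%N.

Definition longest_min_coset_rep J w : Prop :=
  min_coset_rep J w /\
  forall u, min_coset_rep J u -> (weyl_length u <= weyl_length w)%N.

(* Used on the weights of a module only.  A chain of simple root steps starting
   in the weight lattice stays in it, so the lattice need not be mentioned. *)
Definition root_le : hd -> hd -> Prop :=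
  clos_refl_trans hd (fun mu nu => exists i, nu - mu = simple_root D i).

Definition highest_weight (V : lieModule g) mu : Prop :=
  is_weight V mu /\ forall nu, is_weight V nu -> root_le nu mu.

Definition minuscule_module (V : lieModule g) : Prop :=
  [/\ irreducible_module V, nontrivial_module V &
      forall mu nu, is_weight V mu -> is_weight V nu ->
        exists2 w, parabolic predT w & w mu = nu].

Definition weight_join (V : lieModule g) mu nu theta : Prop :=
  [/\ is_weight V theta, root_le mu theta, root_le nu theta &
      forall eta, is_weight V eta -> root_le mu eta -> root_le nu eta ->
        root_le theta eta].

(* The minimum of the weight poset is not join-irreducible. *)
Definition join_irreducible (V : lieModule g) theta : Prop :=
  [/\ is_weight V theta,
      ~ (forall eta, is_weight V eta -> root_le theta eta) &
      forall mu nu, is_weight V mu -> is_weight V nu ->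
        weight_join V mu nu theta -> theta = mu \/ theta = nu].

(* P is (isomorphic to) the minuscule poset P_V. *)
Definition minuscule_poset (V : lieModule g)
    (disp : Order.disp_t) (P : finPOrderType disp) : Prop :=
  exists f : P -> hd,
    [/\ forall p q : P, (p <= q)%O <-> root_le (f p) (f q),
        injective f &
        forall mu, join_irreducible V mu <-> exists p, f p = mu].

Definition weyl_commute (i j : 'I_n) : bool :=
  (simple_reflection i \o simple_reflection j)%VF
    == (simple_reflection j \o simple_reflection i)%VF.

(* Later letters of the word are lower in the heap. *)
Definition heap_le (l : nat) (a : l.-tuple 'I_n) : rel 'I_l :=
  connect (fun x y : 'I_l => (y < x)%N && ~~ weyl_commute (tnth a x) (tnth a y)).

Definition heap_labeling lambda (disp : Order.disp_t) (P : finPOrderType disp)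
    (label : P -> 'I_n) : Prop :=
  exists (w : 'End(hd)) (l : nat) (a : l.-tuple 'I_n) (f : 'I_l -> P),
    [/\ longest_min_coset_rep (stabilizer_set lambda) w,
        reduced_word w a,
        bijective f,
        forall x y : 'I_l, heap_le a x y = (f x <= f y)%O &
        forall x : 'I_l, label (f x) = tnth a x].

End WeylGroup.

(* Main.v *)
From HB Require Import structures.
Require Import Defs.
From mathcomp Require Import all_boot all_order all_algebra all_fingroup.
From mathcomp Require Import reals.
From mathcomp.real_closed Require Import complex.
From mathcomp Require boolp.
From mathcomp Require Import zify ring.

Set Implicit Arguments.
Unset Strict Implicit.
Unset Printing Implicit Defensive.

Import Order.TTheory GRing.Theory Num.Theory.

(** Both permutations are products of all the toggles, each taken once:
    the Fon-Der-Flaass action sweeps [P] from top to bottom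
    ([fon_der_flaass_word]), and the toggle sequence runs through [P] label
    class by label class.  Toggles at elements that do not cover one another
    commute ([toggle_commute]), so such a product depends only on the
    orientation that the order of the factors induces on the Hasse diagram.

    Suppose that an orientation comes from a height function on [P] changing by
    exactly 1 along every Hasse edge.  Moving the top level to the front of the
    word conjugates the product by an element of the toggle group and lowers
    that level by 2; after finitely many such moves only the parity of the
    height is left ([ordered_parity]).  Two height functions of the same parity
    therefore give conjugate products.  Hence the theorem follows from two
    facts on the heap: [P] is graded ([heap_graded]), which supplies a height
    for the sweep, and the noncommutation graph of the labels that occur is a
    forest, so that any ordering of the generators comes from a height on the
    labels ([label_height]).  As Hasse edges join elements with noncommuting
    labels, both heights change parity along each edge, and a parity correction
    makes the parities agree.

    Both facts come out of the numbers game.  Firing the letters of the reduced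
    word of [w_0^J] from right to left moves the highest weight down, and each
    firing is made at a coordinate of value exactly 1.  Comparing this value at
    consecutive firings of a generator [s_i] shows that the neighbours of [i]
    fired in between have total weight 2, and that before the first firing of
    [s_i] at most one neighbour has been fired.  The latter makes the label
    graph a forest.  The former makes [P] graded: if [x] covers two elements,
    both of them cover the previous element with the label of [x].

    That every firing has value 1 is [reduced_min_coset_descending].  Weights of
    a minuscule module take values in {-1, 0, 1} on simple coroots: a weight
    strictly inside a string would be moved to the highest weight by the Weyl
    group, leaving weights on both sides of it ([minuscule_weight_value]).  With
    values so restricted, rank-two computations show that any word equals a
    descending word times a word in [W_J] and that the descending word is
    shorter unless the word was already descending
    ([descending_decomposition]); minimality of the coset representative does
    the rest.  The Lie-theoretic input is the representation theory of sl2,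
    applied to the module and to the adjoint module. *)

(** * Words in partially commuting elements *)

Section Words.
Context {T : finType} {gT : finGroupType}.
Variables (t : T -> gT) (adj : rel T).
Hypothesis adj_sym : symmetric adj.
Hypothesis t_comm : forall p q, ~~ adj p q -> commute (t p) (t q).
Local Open Scope group_scope.
Implicit Types (s u v : seq T) (r : T -> nat).

Definition word_eval s : gT := \prod_(p <- s) t p.

(** The word [s] realises the orientation of the graph [adj] towards larger
    values of [r]. *)
Definition ordered r s : bool := pairwise (fun p q => adj p q ==> (r p < r q)) s.

Definition unit_steps r : Prop :=
  forall p q, adj p q -> r q = (r p).+1 \/ r p = (r q).+1.

Lemma word_eval_pull u x :
  all (fun q => ~~ adj q x) u -> word_eval (rcons u x) = t x * word_eval u.
Proof.
elim: u => [|y u IHu] /=; first by rewrite /word_eval big_seq1 big_nil mulg1.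
case/andP=> yx /IHu; rewrite /word_eval !big_cons => ->.
by rewrite !mulgA (t_comm yx).
Qed.

(** The first letter of one word can be pulled to the front of the other: any
    letter in its way that is adjacent to it would have to be both above and
    below it for [r]. *)
Lemma ordered_eval_eq r s s' :
  perm_eq s s' -> ordered r s -> ordered r s' -> word_eval s = word_eval s'.
Proof.
elim: s s' => [|x s IHs] s' eq_s.
  by move: eq_s; rewrite perm_sym => /perm_nilP->.
have xs' : x \in s' by rewrite -(perm_mem eq_s) mem_head.
case/splitPr: s' / xs' eq_s => u v eq_s ord_s ord_s'.
have {}eq_s : perm_eq s (u ++ v).
  rewrite -(perm_cons x); apply: perm_trans eq_s _.
  by rewrite -cat1s perm_catCA.
move: ord_s; rewrite /ordered /= => /andP[/allP xmin ord_s].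
move: ord_s'; rewrite /ordered pairwise_cat pairwise_cons.
case/and3P=> /allrelP uxv ord_u /andP[xv ord_v].
have ux : all (fun q => ~~ adj q x) u.
  apply/allP => q qu; apply/negP => qx.
  have /xmin : q \in s by rewrite (perm_mem eq_s) mem_cat qu.
  have := uxv q x qu (mem_head _ _).
  rewrite qx adj_sym qx /= => ltqx ltxq.
  by have := ltn_trans ltqx ltxq; rewrite ltnn.
have ord_uv : ordered r (u ++ v).
  rewrite /ordered pairwise_cat ord_u ord_v !andbT.
  by apply/allrelP => y z yu zv; rewrite uxv // in_cons zv orbT.
have -> : word_eval (x :: s) = t x * word_eval s by rewrite /word_eval big_cons.
rewrite (IHs _ eq_s ord_s ord_uv) -cat_rcons /word_eval !big_cat /= mulgA.
by congr (_ * _); rewrite -[LHS]word_eval_pull.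
Qed.

Lemma word_eval_gen s : word_eval s \in <<[set t p | p : T]>>.
Proof. by apply: group_prod => p _; apply/mem_gen/imset_f. Qed.

Lemma word_eval_rot u v :
  word_eval (u ++ v) = word_eval (v ++ u) ^ (word_eval u)^-1.
Proof. by rewrite /word_eval !big_cat /= conjgE invgK -!mulgA mulgV mulg1. Qed.

Lemma ordered_filter r s (a : pred T) : ordered r s -> ordered r (filter a s).
Proof. exact/subseq_pairwise/filter_subseq. Qed.

(** Induction on the maximum [N] of [r].  The letters at level [N] can be
    written last; moving them to the front conjugates the product, and the
    rotated word is ordered for the function where level [N] has been pushed
    down to [N - 2], since all neighbours of level [N] lie at level [N - 1]. *)
Lemma ordered_parity r s :
    unit_steps r -> ordered r s ->
  exists2 s', perm_eq s s' && ordered (odd \o r) s' &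
    exists2 g, g \in <<[set t p | p : T]>> & word_eval s = word_eval s' ^ g.
Proof.
have: exists N, forall p, r p <= N by exists (\max_p r p) => p; apply: leq_bigmax.
case=> N; elim/ltn_ind: N r s => -[|[|N]] IH r s leN steps ord_s; last first.
- pose top p := r p == N.+2; pose r2 p := if top p then N else r p.
  set s1 := filter (predC top) s; set s2 := filter top s.
  have eq_s : perm_eq s (s1 ++ s2) by rewrite perm_sym perm_catC perm_filterC.
  have ord_s12 : ordered r (s1 ++ s2).
    rewrite /ordered pairwise_cat; apply/and3P; split; try exact: ordered_filter.
    apply/allrelP => p q; rewrite !mem_filter => /andP[/= pt _] /andP[/eqP qt _].
    by apply/implyP => _; rewrite qt ltn_neqAle pt leN.
  have r2lt p : r2 p <= N.+1.
    rewrite /r2; case: ifP => [_ // | /negbT pt].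
    by rewrite -ltnS ltn_neqAle pt leN.
  have r2top p q : adj p q -> top p -> r q = N.+1.
    move=> pq /eqP pt; have := leN q; case: (steps _ _ pq); rewrite pt; last by case.
    by move=> ->; rewrite ltnn.
  have steps2 : unit_steps r2.
    move=> p q pq; have qp : adj q p by rewrite adj_sym.
    rewrite /r2; case: ifP => qt.
      by rewrite /top (r2top _ _ qp qt) eqn_leq ltnn andbF; right.
    case: ifP => pt; first by left; apply: r2top pt.
    exact: steps.
  have ord2 : ordered r2 (s2 ++ s1).
    rewrite /ordered pairwise_cat; apply/and3P; split.
    - apply/allrelP => p q; rewrite !mem_filter => /andP[pt _] /andP[/negPf qt _].
      apply/implyP => pq; rewrite /r2 pt; move: qt => /= ->.
      by rewrite (r2top _ _ pq pt).
    - apply: (sub_in_pairwise (P := top)) (filter_all top s) (ordered_filter top ord_s).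
      move=> p q pt qt /implyP pq; apply/implyP => /pq.
      by rewrite (eqP pt) (eqP qt) ltnn.
    - apply: (sub_in_pairwise (P := predC top)) (filter_all _ s) (ordered_filter _ ord_s).
      by move=> p q /negPf /= pt /negPf /= qt; rewrite /r2 pt qt.
  have [s' /andP[eq' ord'] [g gG eqg]] := IH _ (ltnSn _) r2 _ r2lt steps2 ord2.
  exists s'.
    apply/andP; split.
      by apply: perm_trans eq_s _; rewrite perm_catC.
    move: ord'; congr is_true; apply: eq_pairwise => p q /=.
    by rewrite /r2; do 2!case: ifP => [/eqP-> |_] //=; rewrite negbK.
  exists (g * (word_eval s1)^-1); first by rewrite groupM // groupV word_eval_gen.
  by rewrite (ordered_eval_eq eq_s ord_s ord_s12) word_eval_rot eqg conjgM.
all: exists s; last by exists 1; rewrite ?group1 ?conjg1.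
all: rewrite perm_refl; move: ord_s; congr is_true; apply: eq_pairwise => p q /=.
all: by move: (leN p) (leN q); case: (r p) (r q) => [|[|?]] [|[|?]].
Qed.

End Words.

(** * Toggles and the Fon-Der-Flaass action *)

Section Toggles.
Context {disp : Order.disp_t} {P : finPOrderType disp}.
Implicit Types (I : ideals P) (A : {set P}) (p q r : P).
Local Open Scope order_scope.

Definition covers p q : bool := (p < q) && [forall r, ~~ ((p < r) && (r < q))].

Definition hasse : rel P := fun p q => covers p q || covers q p.

Lemma hasse_sym : symmetric hasse.
Proof. by move=> p q; rewrite /hasse orbC. Qed.

Lemma coversP p q :
  reflect (p < q /\ forall r, p < r -> r < q -> False) (covers p q).
Proof.
apply: (iffP andP) => -[pq noq]; split=> //.
  by move=> r pr rq; have /forallP/(_ r) := noq; rewrite pr rq.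
by apply/forallP => r; apply/negP => /andP[]; apply: noq.
Qed.

Lemma covers_above p q : p < q -> exists2 r, covers p r & r <= q.
Proof.
move=> pq; have : q \in [set x | p < x & x <= q] by rewrite inE pq lexx.
case/above_minimal=> r; rewrite !inE => /andP[/andP[pr rq] /forall_inP rmin] _.
exists r => //; apply/coversP; split=> // x px xr.
by have := rmin x; rewrite inE px (le_trans (ltW xr) rq) xr => /(_ isT).
Qed.

Lemma covers_below p q : p < q -> exists2 r, covers r q & p <= r.
Proof.
move=> pq; have : p \in [set x | x < q & p <= x] by rewrite inE pq lexx.
case/below_maximal=> r; rewrite !inE => /andP[/andP[rq pr] /forall_inP rmax] _.
exists r => //; apply/coversP; split=> // x rx xq.
by have := rmax x; rewrite inE xq (le_trans pr (ltW rx)) rx => /(_ isT).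
Qed.

Definition togglable p A : bool :=
  if p \in A then [forall r, (p < r) ==> (r \notin A)]
  else [forall r, (r < p) ==> (r \in A)].

(** For an order ideal it is enough to look at the neighbours of [p] in the
    Hasse diagram, which is why toggling elsewhere leaves the toggle at [p]
    undisturbed. *)
Lemma togglableE p I :
  togglable p I =
    if p \in (I : {set P}) then [forall r, covers p r ==> (r \notin (I : {set P}))]
    else [forall r, covers r p ==> (r \in (I : {set P}))].
Proof.
have /down_closedP dI := ideal_closed I.
rewrite /togglable; case: ifP => pI; apply/forallP/forallP => H r.
- apply/implyP => /coversP[pr _]; exact: implyP (H r) pr.
- apply/implyP => /covers_above[x px xr]; apply: contra (implyP (H x) px) => rI.
  exact: dI xr.
- apply/implyP => /coversP[rp _]; exact: implyP (H r) rp.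
- apply/implyP => /covers_below[x xp rx]; apply: dI (implyP (H x) xp) rx.
Qed.

Lemma down_closed_toggle p I : down_closed (toggle_set p I) = togglable p I.
Proof.
have /down_closedP dI := ideal_closed I.
rewrite /togglable; apply/(down_closedP _)/idP => [dT | ].
  case: ifP => pI; apply/forallP => r; apply/implyP => pr.
    apply: contraT; rewrite negbK => rI.
    have := dT p r; rewrite !inE rI pI eqxx (gt_eqF pr) /=.
    by move=> /(_ isT (ltW pr)).
  have := dT r p; rewrite !inE pI eqxx (lt_eqF pr) /=.
  by move=> /(_ isT (ltW pr)); rewrite andbF orbF.
case: ifP => pI /forallP H x y; rewrite !inE.
  have [-> | yp] := eqVneq y p; rewrite ?pI ?eqxx //= andbF orbF => yI xy.
  rewrite (dI _ _ yI xy) /= orbF andbT; apply: contraTN yI => xp.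
  by apply: (implyP (H y)); rewrite lt_neqAle eq_sym yp -(eqP xp).
have [-> _ xy | yp] := eqVneq y p.
  have [-> | xp] := eqVneq x p; first by rewrite pI.
  by rewrite (implyP (H x)) // lt_neqAle xp.
rewrite /= andbF orbF => yI xy; rewrite (dI _ _ yI xy) /= orbF andbT.
by apply: contraFneq pI => <-; apply: dI xy.
Qed.

Lemma mem_toggle p I q :
  (q \in (toggle p I : {set P})) =
    (q \in (I : {set P})) (+) ((q == p) && togglable p I).
Proof.
rewrite permE /toggle_fun val_insubd down_closed_toggle.
case: (togglable p I); last by rewrite andbF addbF.
by rewrite andbT !inE; case: (q == p); case: (q \in _).
Qed.

Lemma togglable_toggle p q I :
  q != p -> ~~ hasse p q -> togglable q (toggle p I) = togglable q I.
Proof.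
move=> qp; rewrite negb_or => /andP[npq nqp].
rewrite !togglableE mem_toggle (negPf qp) addbF.
case: ifP => _; apply: eq_forallb => r; rewrite mem_toggle.
  by case: (eqVneq r p) => [-> | _]; rewrite ?(negPf nqp) // addbF.
by case: (eqVneq r p) => [-> | _]; rewrite ?(negPf npq) // addbF.
Qed.

Lemma toggle_commute p q : ~~ hasse p q -> commute (toggle p) (toggle q).
Proof.
have [-> // | qp] := eqVneq q p; move=> npq.
apply/permP => I; rewrite !permM; apply/val_inj/setP => x.
rewrite !mem_toggle !togglable_toggle //.
- by rewrite -!addbA; congr (_ (+) _); rewrite addbC.
- by rewrite eq_sym.
- by rewrite hasse_sym.
Qed.

(** When [p] is reached, the elements above [p] already have their status in
    the Fon-Der-Flaass image and those below still have their status in [I].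
    So [p] in [I] is kept exactly when some larger element is in the image, and
    [p] outside [I] is added exactly when it is minimal outside [I]; both agree
    with membership in the image. *)
Lemma top_down_sweep u I x :
    uniq u -> pairwise (fun p q => ~~ (p < q)) u ->
    (forall p q, p \in u -> p < q -> q \in u) ->
  (x \in (word_eval toggle u I : {set P})) =
    (x \in if x \in u then fdf_fun I : {set P} else I).
Proof.
elim/last_ind: u x => [|u p IHu] x; first by rewrite /word_eval big_nil perm1.
rewrite rcons_uniq -cats1 pairwise_cat => /andP[pu uniq_u].
case/and3P=> /allrelP/(_ _ p _ (mem_head _ _)) up pw_u _ up_closed'.
have up_closed y z : y \in u -> y < z -> z \in u.
  move=> yu yz; have := up_closed' y z; rewrite !mem_cat yu => /(_ isT yz).
  by rewrite inE => /orP[// | /eqP zp]; have := up y yu; rewrite -zp yz.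
have {}IHu y := IHu y uniq_u pw_u up_closed.
have nup q : q \in u -> ~~ (q < p) by apply: up.
have pup q : p < q -> q \in u.
  move=> pq; have := up_closed' p q; rewrite mem_cat mem_head orbT.
  by rewrite mem_cat inE => /(_ isT pq) /orP[// | /eqP qp]; rewrite qp ltxx in pq.
rewrite mem_cat inE /word_eval big_cat big_seq1 /= permM -/(word_eval _ _).
rewrite mem_toggle IHu; case: (eqVneq x p) => [-> | xp] /=; last first.
  by rewrite addbF orbF.
rewrite (negPf pu) orbT /togglable !IHu (negPf pu).
have [pI | pI] := boolP (p \in (I : {set P})).
  rewrite addTb negb_forall; apply/existsP/idP => [[r] | pF].
    rewrite negb_imply negbK => /andP[pr]; rewrite IHu (pup _ pr) => rF.
    have /down_closedP := ideal_closed (fdf_fun I).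
    by apply; [exact: rF | exact: ltW].
  have := pF; rewrite inE => /exists_inP[m mmin pm].
  have ltpm : p < m.
    rewrite lt_neqAle pm andbT; apply: contraTneq mmin => <-.
    by rewrite !inE pI.
  exists m; rewrite ltpm negbK IHu (pup _ ltpm) inE.
  by apply/exists_inP; exists m.
apply/forallP/idP => [H | ].
  rewrite inE; apply/exists_inP; exists p => //.
  rewrite !inE pI; apply/forall_inP => r; rewrite inE; apply: contra => rp.
  have := implyP (H r) rp; rewrite IHu ifN //.
  by apply: contraL rp; apply: nup.
rewrite inE => /exists_inP[m]; rewrite !inE => /andP[mI /forall_inP mmin] pm r.
apply/implyP => rp; rewrite IHu ifN; last by apply: contraL rp; apply: nup.
by apply: contraLR (lt_le_trans rp pm) => rI; apply: mmin; rewrite inE.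
Qed.

Lemma fon_der_flaass_word s :
    perm_eq s (enum P) -> pairwise (fun p q => ~~ (p < q)) s ->
  fon_der_flaass = word_eval toggle s.
Proof.
move=> eq_s pw; have in_s x : x \in s by rewrite (perm_mem eq_s) mem_enum.
apply/permP => I; apply/val_inj/setP => x; rewrite permE /=.
by rewrite top_down_sweep ?(perm_uniq eq_s) ?enum_uniq ?in_s.
Qed.

End Toggles.

(** * Minuscule heaps *)

Lemma leq_sum_uniq (T : finType) (A : pred T) (F : T -> nat) (s : seq T) :
  uniq s -> all A s -> all (fun p => 0 < F p) s -> size s <= \sum_(p | A p) F p.
Proof.
move=> uniq_s As Fs; rewrite (bigID (mem s)) /=; apply: leq_trans (leq_addr _ _).
rewrite (eq_bigl (mem s)) => [|p]; last first.
  by apply/andP/idP => [[] // | ps]; rewrite (allP As).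
rewrite -big_uniq //=; elim: s Fs {As uniq_s} => [|p s IHs] //= /andP[Fp /IHs les].
by rewrite big_cons -add1n leq_add.
Qed.

Lemma pairwise_flatten (T : Type) (e : rel T) (ss : seq (seq T)) :
  pairwise e (flatten ss) = all (pairwise e) ss && pairwise (allrel e) ss.
Proof.
elim: ss => //= s ss IHss; rewrite pairwise_cat {}IHss.
have -> : allrel e s (flatten ss) = all (allrel e s) ss.
  by elim: ss => [|t ss IHss] /=; rewrite ?allrel0r // allrel_catr IHss.
by do !bool_congr.
Qed.

(** The heap is seen through the times at which its elements are fired.  The
    number [c i j] stands for minus the pairing of the root of [j] with the
    coroot of [i], set to 0 on the diagonal, and [lam] for the coordinates of the
    highest weight.  The hypothesis [firing_balance] says that the coordinate at
    the label of [x] is 1 when [x] is fired: it started at [lam], gained [c] at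
    each firing of a neighbour and lost 2 at each firing of the same label. *)
Section HeapCombinatorics.
Context {disp : Order.disp_t} {P : finPOrderType disp} {n : nat}.
Variables (label : P -> 'I_n) (time : P -> nat).
Variables (c : 'I_n -> 'I_n -> nat) (lam : 'I_n -> nat).
Hypothesis time_inj : injective time.
Hypothesis lt_time : forall p q : P, (p < q)%O -> time p < time q.
Hypothesis c_sym0 : forall i j, (c i j == 0) = (c j i == 0).
Hypothesis c_diag : forall i, c i i = 0.
Hypothesis covers_linked : forall p q, covers p q -> c (label p) (label q) != 0.
Hypothesis linked_lt :
  forall p q, c (label p) (label q) != 0 -> time p < time q -> (p < q)%O.
Hypothesis firing_balance : forall x,
  lam (label x) + \sum_(y | time y < time x) c (label x) (label y) =
    1 + 2 * #|[set y | time y < time x & label y == label x]|.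

(** At a first firing the balance reads [lam + sum = 1], so the sum has room for
    one neighbour only.  This is what makes the label graph a forest. *)
Lemma first_occurrence x y z :
    (forall w, time w < time x -> label w != label x) ->
    time y < time x -> time z < time x ->
    c (label x) (label y) != 0 -> c (label x) (label z) != 0 -> y = z.
Proof.
move=> first yx zx cy cz; apply/eqP/negPn/negP => yz.
have := firing_balance x; rewrite eq_card0 => [|w]; last first.
  by rewrite inE; apply/negP => /andP[/first/negPf->].
have := @leq_sum_uniq P (fun y => time y < time x) (fun y => c (label x) (label y))
  [:: y; z]; rewrite /= inE yz yx zx !lt0n cy cz => /(_ isT isT isT); lia.
Qed.

(** Subtract the balances at [x] and at the last earlier element [x'] with the
    same label. *)
Lemma previous_occurrence x w :
    time w < time x -> label w = label x ->
  exists x', [/\ time x' < time x, label x' = label x &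
    \sum_(y | time x' < time y < time x) c (label x) (label y) = 2].
Proof.
move=> wx lw; pose B y := (time y < time x) && (label y == label x).
have Bw : B w by rewrite /B wx lw eqxx.
case: (arg_maxnP time Bw) => x' /andP[x'x /eqP lx'] x'max.
exists x'; split=> //; have := firing_balance x'; have := firing_balance x.
rewrite lx' (bigID (fun y => time y < time x')) /=.
have -> : \sum_(y | (time y < time x) && (time y < time x')) c (label x) (label y) =
          \sum_(y | time y < time x') c (label x) (label y).
  by apply: eq_bigl => y; rewrite andb_idl // => /ltn_trans; apply.
have -> : \sum_(y | (time y < time x) && ~~ (time y < time x')) c (label x) (label y) =
          \sum_(y | time x' < time y < time x) c (label x) (label y).
  rewrite (bigD1 x') /= ?x'x ?ltnn // lx' c_diag add0n; apply: eq_bigl => y.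
  rewrite -leqNgt [time x' < _]ltn_neqAle (inj_eq time_inj) eq_sym.
  by rewrite andbC -andbA; congr (_ && _); rewrite andbC.
rewrite (cardsD1 x' [set y | time y < time x & _]) inE x'x lx' eqxx /=.
suff -> : [set y | time y < time x & label y == label x] :\ x' =
          [set y | time y < time x' & label y == label x].
  move: (#|[set y | time y < time x' & label y == label x]|) => N.
  move: (\sum_(y | time y < time x') _) => A.
  move: (\sum_(y | time x' < time y < time x) _) => C.
  lia.
apply/setP => y; rewrite !inE.
have [-> | yx'] := eqVneq y x'; first by rewrite ltnn.
rewrite /=; case: (eqVneq (label y) (label x)) => ly; rewrite ?andbF // !andbT.
apply/idP/idP => [yx | /ltn_trans]; last by apply.
have : time y <= time x' by apply: x'max; rewrite /B yx ly eqxx.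
by rewrite leq_eqVlt (inj_eq time_inj) (negPf yx').
Qed.

Lemma linked_between x x' y :
    label x' = label x -> time x' < time y < time x ->
    c (label x) (label y) != 0 -> (x' < y < x)%O.
Proof.
move=> lx' /andP[x'y yx] cxy; rewrite !linked_lt ?lx' //.
by rewrite c_sym0.
Qed.

(** The total 2 between [x'] and [x] is used up by the two elements that [x]
    covers.  If one of them did not cover [x'], there would be a cover of [x']
    strictly below it, distinct from the other one because [x] covers both: a
    third neighbour of the label of [x] fired between [x'] and [x]. *)
Lemma cover_prev x w z1 z2 :
    time w < time x -> label w = label x ->
    covers z1 x -> covers z2 x -> z1 != z2 ->
  exists2 x', covers x' z1 & covers x' z2.
Proof.
move=> wx lw z1x z2x z12.
have [x' [x'x lx' sum2]] := previous_occurrence wx lw.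
have ltx'x : (x' < x)%O.
  have : \sum_(y | time x' < time y < time x) c (label x) (label y) != 0.
    by rewrite sum2.
  rewrite sum_nat_eq0 negb_forall => /existsP[y]; rewrite negb_imply.
  case/andP=> x'yx /(linked_between lx' x'yx)/andP[]; exact: lt_trans.
have link z : covers z x -> c (label x) (label z) != 0.
  by move=> zx; rewrite c_sym0; apply: covers_linked.
have between z : covers z x -> time x' < time z < time x.
  move=> zx; have /coversP[/lt_time zx' nob] := zx; rewrite zx' andbT.
  rewrite ltnNge leq_eqVlt (inj_eq time_inj); apply/norP; split.
    by apply: contraTneq (link _ zx) => ->; rewrite lx' c_diag.
  apply/negP => zx''; apply: nob ltx'x; apply: linked_lt zx''.
  by rewrite lx'; apply: covers_linked.
suff cov a b : covers a x -> covers b x -> a != b -> covers x' a.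
  by exists x'; [apply: cov z12 | apply: (cov z2 z1); rewrite // eq_sym].
move=> ax bx ab; have /andP[x'a _] := linked_between lx' (between a ax) (link a ax).
have [u x'u ua] := covers_above x'a.
have [-> // | neq_ua] := eqVneq a u.
have [eq_bu | neq_ub] := eqVneq b u.
  have /coversP[_ /(_ a)] := bx; case; last by case/coversP: ax.
  by rewrite lt_neqAle eq_sym ab eq_bu.
have lt_ua : (u < a)%O by rewrite lt_neqAle eq_sym neq_ua.
have /andP[_ a_x] := between a ax.
have := @leq_sum_uniq P (fun y => time x' < time y < time x)
  (fun y => c (label x) (label y)) [:: a; b; u].
rewrite sum2 /= !inE negb_or ab neq_ua neq_ub (between a) // (between b) //.
rewrite !lt0n (link a) // (link b) //=.
rewrite (ltn_trans (lt_time lt_ua) a_x) lt_time ?andbT; last by case/coversP: x'u.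
by rewrite -lx' covers_linked // => /(_ isT isT isT).
Qed.

(** Ranks are assigned in the order of firing.  Two elements covered by the
    element [x] fired at time [m] either do not exist, at a first occurrence, or
    have the same rank because both cover the previous occurrence. *)
Lemma heap_graded : exists r : P -> nat, forall p q, covers p q -> r q = (r p).+1.
Proof.
suff H m : exists r : P -> nat,
    forall p q, time q < m -> covers p q -> r q = (r p).+1.
  have [r Hr] := H (\max_p time p).+1.
  by exists r => p q; apply: Hr; rewrite ltnS leq_bigmax.
elim: m => [|m [r IHr]]; first by exists (fun=> 0).
case: (pickP (fun x => time x == m)) => [x /eqP xm | nox]; last first.
  exists r => p q; rewrite ltnS leq_eqVlt nox; exact: IHr.
have same p q : covers p x -> covers q x -> r p = r q.
  move=> px qx; have [-> // | pq] := eqVneq p q.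
  have [ltp _] := coversP _ _ px; have [ltq _] := coversP _ _ qx.
  case: (pickP (fun w => (time w < time x) && (label w == label x))).
    move=> w /andP[wx /eqP lw].
    have [x' x'p x'q] := cover_prev wx lw px qx pq.
    by rewrite (IHr _ _ _ x'p) ?(IHr _ _ _ x'q) // -xm lt_time.
  move=> first; case/eqP: pq; apply: (@first_occurrence x).
  - by move=> w wx; have := first w; rewrite wx /= => ->.
  - exact: lt_time.
  - exact: lt_time.
  - by rewrite c_sym0 covers_linked.
  - by rewrite c_sym0 covers_linked.
exists (fun y => if y == x then (if [pick p | covers p x] is Some p then (r p).+1 else 0)
  else r y) => p q qm pq.
have /negPf-> : p != x.
  apply: contraTneq qm => px; rewrite px in pq; have /coversP[/lt_time + _] := pq.
  by rewrite xm ltnS -ltnNge.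
have [qx | qx] := eqVneq q x.
  rewrite qx in pq; case: pickP => [p' p'x | /(_ p)]; last by rewrite pq.
  by rewrite (same p p').
by apply: IHr pq; move: qm; rewrite ltnS leq_eqVlt -xm (inj_eq time_inj) (negPf qx).
Qed.

(** Labels are added in the order of their first firing.  A new label has at
    most one neighbour among the earlier ones, so its height can be chosen just
    above or just below that of its neighbour. *)
Lemma label_height (pos : 'I_n -> nat) :
  injective pos ->
  exists h : 'I_n -> nat, forall p q : P,
    c (label p) (label q) != 0 -> pos (label p) < pos (label q) ->
    h (label q) = (h (label p)).+1.
Proof.
move=> pos_inj; suff H m : exists h : 'I_n -> nat, forall p q : P,
    time p < m -> time q < m ->
    c (label p) (label q) != 0 -> pos (label p) < pos (label q) ->
    h (label q) = (h (label p)).+1.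
  have [h Hh] := H (\max_p time p).+1.
  by exists h => p q; apply: Hh; rewrite ltnS leq_bigmax.
elim: m => [|m [h IHh]]; first by exists (fun=> 0).
case: (pickP (fun x => time x == m)) => [x /eqP xm | nox]; last first.
  have old p : time p < m.+1 -> time p < m by rewrite ltnS leq_eqVlt nox.
  by exists h => p q /old pm /old qm; apply: IHh.
have old p : time p < m.+1 -> p != x -> time p < m.
  by rewrite ltnS leq_eqVlt -xm (inj_eq time_inj) => /orP[/eqP-> | //]; rewrite eqxx.
case: (pickP (fun w => (time w < m) && (label w == label x))) => [w | first].
  case/andP=> wm /eqP lw; exists h => p q pm qm.
  have [p' [p'm ->]] : exists p', time p' < m /\ label p = label p'.
    by have [-> | /(old p pm)] := eqVneq p x; [exists w | exists p].
  have [q' [q'm ->]] : exists q', time q' < m /\ label q = label q'.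
    by have [-> | /(old q qm)] := eqVneq q x; [exists w | exists q].
  exact: IHh.
have new p : time p < m -> (label p == label x) = false.
  by move=> pm; have := first p; rewrite pm.
(* The earlier heights are all raised by 1, to leave room for a new height just
   below one of them; hence the offsets 0 and 2 in [hx]. *)
pose nb y := (time y < m) && (c (label x) (label y) != 0).
pose hx := if [pick y | nb y] is Some y then
  (if pos (label x) < pos (label y) then h (label y) else (h (label y)).+2) else 0.
exists (fun i => if i == label x then hx else (h i).+1) => p q pm qm cpq.
have hxE y : time y < m -> c (label x) (label y) != 0 -> hx =
  if pos (label x) < pos (label y) then h (label y) else (h (label y)).+2.
  move=> ym cxy; rewrite /hx; case: pickP => [z /andP[zm cxz] | /(_ y)]; last first.
    by rewrite /nb ym cxy.
  suff -> : z = y by [].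
  by apply: (@first_occurrence x) => //; rewrite ?xm // => w /new/negbT.
have [px | px] := eqVneq p x; have [qx | qx] := eqVneq q x.
- by rewrite px qx c_diag in cpq.
- rewrite px in cpq *; rewrite eqxx new ?old // => ltpq.
  by rewrite (hxE q) ?old // ltpq.
- rewrite qx in cpq *; rewrite eqxx new ?old // => ltpq.
  by rewrite (hxE p) ?old // 1?c_sym0 // ltnNge (ltnW ltpq).
- by rewrite !new ?old // => ltpq; rewrite (IHh p q) ?old.
Qed.

Lemma toggle_sequence_word (sigma : 'S_n) :
  let pos i := rev_ord (sigma^-1%g i) : nat in
  exists s, [/\ perm_eq s (enum P),
    toggle_sequence label sigma = word_eval toggle s &
    pairwise (fun p q => pos (label p) <= pos (label q)) s].
Proof.
move=> pos.
pose block (k : 'I_n) := [seq p <- index_enum P | label p == sigma (rev_ord k)].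
have mem_block k p : (p \in block k) = (pos (label p) == k :> nat).
  rewrite mem_filter mem_index_enum andbT /pos.
  rewrite -[RHS]/(rev_ord _ == k) (can2_eq rev_ordK rev_ordK).
  by rewrite (can2_eq (permKV sigma) (permK sigma)).
exists (flatten [seq block k | k <- index_enum 'I_n]); split.
- apply: uniq_perm; rewrite ?enum_uniq //; last first.
    move=> p; rewrite mem_enum inE; apply/flatten_mapP.
    by exists (rev_ord (sigma^-1%g (label p))); rewrite ?mem_index_enum // mem_block.
  rewrite uniq_pairwise pairwise_flatten all_map pairwise_map.
  apply/andP; split.
    by apply/allP => k _ /=; rewrite -uniq_pairwise filter_uniq ?index_enum_uniq.
  have := index_enum_uniq 'I_n; rewrite uniq_pairwise.
  apply: sub_pairwise => k k' /= kk'; apply/allrelP => p q; rewrite !mem_block.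
  move=> /eqP pk /eqP qk'; apply: contraNneq kk' => pq; apply/eqP/val_inj.
  by rewrite /= -pk -qk' pq.
- rewrite /toggle_sequence /label_toggle /word_eval big_flatten big_map.
  by apply: eq_bigr => k _; rewrite big_filter.
rewrite pairwise_flatten all_map pairwise_map; apply/andP; split.
  apply/allP => k _ /=.
  have all_related (t : seq P) : pairwise (fun _ _ => true) t.
    by elim: t => //= p t ->; rewrite andbT; apply/allP.
  apply: (sub_in_pairwise (P := mem (block k))) (allss _) (all_related _) => p q.
  by rewrite [p \in _]mem_block [q \in _]mem_block => /eqP-> /eqP->.
have : pairwise (fun k k' : 'I_n => k < k') (index_enum 'I_n).
  rewrite [index_enum _]unlock -enumT -(pairwise_map val ltn) val_enum_ord.
  by rewrite -(sorted_pairwise ltn_trans) iota_ltn_sorted.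
apply: sub_pairwise => k k' /= kk'; apply/allrelP => p q.
by rewrite !mem_block => /eqP-> /eqP->; apply: ltnW.
Qed.

Theorem heap_conjugate (sigma : 'S_n) :
  exists2 t : {perm ideals P}, t \in toggle_group P &
    fon_der_flaass = (toggle_sequence label sigma ^ t)%g.
Proof.
pose pos i := rev_ord (sigma^-1%g i) : nat.
have pos_inj : injective pos by move=> i j /val_inj/rev_ord_inj/perm_inj.
have [s2 [eq2 -> pw2]] := toggle_sequence_word sigma.
have [r Hr] := heap_graded; have [h Hh] := label_height pos_inj.
pose s1 := sort (fun p q => time q <= time p) (enum P).
have eq1 : perm_eq s1 (enum P) by rewrite perm_sort.
have pw1 : pairwise (fun p q => time q <= time p) s1.
  rewrite -sorted_pairwise; first by apply: sort_sorted => p q; apply: leq_total.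
  by move=> q p r' /[swap]; apply: leq_trans.
have -> : fon_der_flaass = word_eval toggle s1.
  apply: fon_der_flaass_word => //; apply: sub_pairwise pw1 => p q.
  by rewrite leqNgt; apply/contra/lt_time.
have hasse_linked p q : hasse p q -> c (label p) (label q) != 0.
  by case/orP => /covers_linked //; rewrite c_sym0.
(* The sweep starts at the top, so its height is the rank reversed. *)
pose r1 p := \max_q r q - r p; pose r2 p := h (label p).
have r1E p q : covers p q -> r1 p = (r1 q).+1.
  by move=> /Hr rq; have := leq_bigmax (F := r) q; rewrite /r1 rq => /subnSK.
have r2E p q : hasse p q -> pos (label p) < pos (label q) -> r2 q = (r2 p).+1.
  by move=> /hasse_linked; apply: Hh.
have steps1 : unit_steps hasse r1.
  by move=> p q /orP[] /r1E; [right | left].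
have steps2 : unit_steps hasse r2.
  move=> p q pq; have qp : hasse q p by rewrite hasse_sym.
  case: (ltngtP (pos (label p)) (pos (label q))).
  - by left; apply: r2E.
  - by right; apply: r2E.
  - by move/pos_inj => eqpq; have := hasse_linked _ _ pq; rewrite eqpq c_diag.
have ord1 : ordered hasse r1 s1.
  apply: sub_pairwise pw1 => p q ltqp; apply/implyP => /orP[] /[dup] pq /r1E.
    by case/coversP: pq => /lt_time; rewrite ltnNge ltqp.
  by move=> ->.
have ord2 : ordered hasse r2 s2.
  apply: sub_pairwise pw2 => p q; rewrite leq_eqVlt => /orP[/eqP/pos_inj eqpq | ltpq].
    by apply/implyP => /hasse_linked; rewrite eqpq c_diag.
  by apply/implyP => pq; rewrite (r2E _ _ pq).
(* Both heights change parity along Hasse edges, so the correction is constant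
   on the connected components of the Hasse diagram. *)
pose r1' p := r1 p + (odd (r1 p) (+) odd (r2 p)).
have par p q : hasse p q -> odd (r1 p) (+) odd (r2 p) = odd (r1 q) (+) odd (r2 q).
  by move=> pq; case: (steps1 _ _ pq) => ->; case: (steps2 _ _ pq) => -> /=;
     do 2!case: (odd _).
have steps1' : unit_steps hasse r1'.
  move=> p q pq; rewrite /r1' (par _ _ pq).
  by case: (steps1 _ _ pq) => ->; [left | right].
have ord1' : ordered hasse r1' s1.
  apply: sub_pairwise ord1 => p q /implyP ord; apply/implyP => pq.
  by rewrite /r1' (par _ _ pq) ltn_add2r ord.
have [t1 /andP[eqt1 ordt1] [g1 g1G ->]] :=
  ordered_parity hasse_sym toggle_commute steps1' ord1'.
have [t2 /andP[eqt2 ordt2] [g2 g2G ->]] :=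
  ordered_parity hasse_sym toggle_commute steps2 ord2.
exists (g2^-1 * g1)%g; first by rewrite groupM ?groupV.
rewrite -conjgM mulKVg; congr (_ ^ _)%g.
apply: (ordered_eval_eq hasse_sym toggle_commute _ _ ordt2).
  rewrite perm_sym in eqt1; apply: perm_trans (perm_trans eqt1 _) eqt2.
  by apply: perm_trans eq1 _; rewrite perm_sym.
move: ordt1; congr is_true; apply: eq_pairwise => p q /=.
by rewrite /r1' !oddD !oddb !addKb.
Qed.

End HeapCombinatorics.

(** * Representations of sl2 *)

Section SL2.
Import VectorInternalTheory.
Local Open Scope ring_scope.
Context {F : numFieldType} {V : vectType F}.
Implicit Types (e f h : 'End(V)) (v : V).

Lemma some_not_eigenvalue h (a : nat -> F) :
  injective a -> exists k, forall v, h v = a k *: v -> v = 0.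
Proof.
move=> a_inj; pose M := lin1_mx (v2r \o h \o r2v); pose p := char_poly M.
have p0 : p != 0 by rewrite monic_neq0 // char_poly_monic.
have : ~~ all (root p) [seq a k | k <- iota 0 (size p)].
  apply/negP => roots; have := max_poly_roots p0 roots.
  by rewrite map_inj_uniq // iota_uniq size_map size_iota ltnn => /(_ isT).
rewrite -has_predC => /hasP[_ /mapP[k _ ->] /= nroot]; exists k => v hv.
apply/eqP; apply: contraNT nroot => v0; rewrite -eigenvalue_root_char.
apply/eigenvalueP; exists (v2r v); first by rewrite mul_rV_lin1 /= v2rK hv linearZ.
by rewrite -(inj_eq (can_inj v2rK)) linear0 in v0.
Qed.

Definition sl2_triple e f h : Prop :=
  [/\ forall v, e (f v) = f (e v) + h v,
      forall v, h (e v) = e (h v) + 2%:R *: e v &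
      forall v, h (f v) = f (h v) - 2%:R *: f v].

Lemma sl2_triple_opp e f h : sl2_triple e f h -> sl2_triple f e (- h).
Proof.
by case=> ef he hf; split=> v; rewrite ?opp_lfunE ?linearN /= ?ef ?he ?hf ?addrK //;
  rewrite opprD ?opprK.
Qed.

Lemma sl2_weight_lower e f h v m k :
  sl2_triple e f h -> h v = m *: v ->
  h (iter k f v) = (m - 2%:R * k%:R) *: iter k f v.
Proof.
case=> _ _ hf hv; elim: k => [|k IHk] /=; first by rewrite mulr0 subr0.
rewrite hf IHk linearZ /= -scalerBl -natr1; congr (_ *: _); ring.
Qed.

(** The vectors [f^k v] belong to pairwise distinct eigenvalues of [h], so in
    finite dimension they vanish from some point on. *)
Lemma sl2_lower_nilpotent e f h v m :
  sl2_triple e f h -> h v = m *: v -> v != 0 ->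
  exists N, iter N f v != 0 /\ iter N.+1 f v = 0.
Proof.
move=> tri hv v0.
have [] := @some_not_eigenvalue h (fun k => m - 2%:R * k%:R).
  move=> k l /addrI/oppr_inj/mulfI => /(_ _)/eqP; rewrite eqr_nat => H.
  by apply/eqP/H; rewrite pnatr_eq0.
move=> k /(_ _ (sl2_weight_lower k tri hv)) => fk0.
have exk : exists k, iter k f v == 0 by exists k; rewrite fk0.
case: (ex_minnP exk) => -[|N] /eqP fN0 minN.
  by rewrite /= in fN0; rewrite fN0 eqxx in v0.
by exists N; split=> //; apply/negP => /minN; rewrite ltnn.
Qed.

Lemma sl2_raise_lower e f h v m k :
  sl2_triple e f h -> e v = 0 -> h v = m *: v ->
  e (iter k.+1 f v) = (k.+1%:R * (m - k%:R)) *: iter k f v.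
Proof.
move=> tri ev hv; have [ef _ _] := tri; elim: k => [|k IHk].
  by rewrite /= ef ev linear0 add0r hv mul1r subr0.
rewrite iterS ef IHk linearZ /= (sl2_weight_lower k.+1 tri hv) -scalerDl.
congr (_ *: _); rewrite -!natr1; ring.
Qed.

(** If [f^(N+1) v] is the first power to vanish, applying [e] to it gives
    [(N + 1) (m - N) f^N v = 0], which forces [m = N]. *)
Lemma sl2_highest e f h v m :
  sl2_triple e f h -> v != 0 -> e v = 0 -> h v = m *: v ->
  exists N, m = N%:R /\ forall k, (k <= N)%N -> iter k f v != 0.
Proof.
move=> tri v0 ev hv; have [N [fN fN1]] := sl2_lower_nilpotent tri hv v0.
exists N; split=> [|k kN].
  have /esym/eqP := sl2_raise_lower N tri ev hv; rewrite fN1 linear0.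
  by rewrite scaler_eq0 (negPf fN) orbF mulf_eq0 pnatr_eq0 /= subr_eq0 => /eqP.
apply: contraNneq fN => fk; rewrite -(subnK kN) iterD fk.
by elim: (N - k)%N => //= j /eqP->; rewrite linear0.
Qed.

(** Raise [v] as far as possible, then lower the highest vector so obtained. *)
Lemma sl2_string e f h v m :
  sl2_triple e f h -> v != 0 -> h v = m *: v ->
  exists p N, [/\ m = N%:R - 2%:R * p%:R &
    forall k, (k <= N)%N -> iter k f (iter p e v) != 0].
Proof.
move=> tri v0 hv; have hNv : (- h)%R v = (- m) *: v by rewrite opp_lfunE hv scaleNr.
have [p [ep ep1]] := sl2_lower_nilpotent (sl2_triple_opp tri) hNv v0.
have := sl2_weight_lower p (sl2_triple_opp tri) hNv; rewrite opp_lfunE.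
move/(congr1 -%R); rewrite opprK -scaleNr opprB opprK addrC.
move/(sl2_highest tri ep ep1) => [N [mN fN]]; exists p, N; split=> //.
by rewrite -mN addrK.
Qed.

End SL2.

(** * Weight strings *)

Section LieModules.
Local Open Scope ring_scope.
Context {F : numFieldType} {g : lieAlgebra F}.
Implicit Types (V : lieModule g) (x y : g).

Definition act_lfun V x : 'End(V) := linfun (mod_act x).

Lemma act_lfunE V x (v : V) : act_lfun V x v = mod_act x v.
Proof.
pose f := GRing.isLinear.Build _ _ _ _ _ (@mod_linearr _ _ V x).
pose L : {linear V -> V} := HB.pack (mod_act x) f.
exact: (lfunE L).
Qed.

Lemma linear_funZ (U W : lmodType F) (f : U -> W) :
  linear f -> forall a u, f (a *: u) = a *: f u.
Proof.
move=> lin a u; have f0 : f 0 = 0.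
  by have := lin (-1) 0 0; rewrite !scaleN1r oppr0 addr0 addNr.
by have := lin a u 0; rewrite !addr0 f0 addr0.
Qed.

Lemma mod_actZl V a x (v : V) : mod_act (a *: x) v = a *: mod_act x v.
Proof. exact: linear_funZ (@mod_linearl _ _ V v) a x. Qed.

Lemma lie_skew x y : lie_bracket x y = - lie_bracket y x.
Proof.
have addl (a b c : g) : lie_bracket (a + b) c = lie_bracket a c + lie_bracket b c.
  by have := @lie_linearl _ g c 1 a b; rewrite !scale1r.
have addr (a b c : g) : lie_bracket a (b + c) = lie_bracket a b + lie_bracket a c.
  by have := @lie_linearr _ g a 1 b c; rewrite !scale1r.
have := @lie_alternating _ g (x + y); rewrite addl !addr !lie_alternating.
by rewrite add0r addr0 => /eqP; rewrite addr_eq0 => /eqP.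
Qed.

Lemma adjoint_bracket x y (v : g) :
  lie_bracket (lie_bracket x y) v =
    lie_bracket x (lie_bracket y v) - lie_bracket y (lie_bracket x v).
Proof.
have lieN (a b : g) : lie_bracket a (- b) = - lie_bracket a b.
  by rewrite -!scaleN1r (linear_funZ (@lie_linearr _ g a)).
have /eqP := lie_jacobi x y v.
rewrite [lie_bracket v (lie_bracket x y)]lie_skew subr_eq0 => /eqP <-.
by rewrite [lie_bracket v x]lie_skew lieN.
Qed.

Definition adjoint : lieModule g :=
  LieModule (@lie_linearl _ g) (@lie_linearr _ g) adjoint_bracket.

Section Weights.
Context {h : {vspace g}}.
Implicit Types (mu alpha : cartan_dual h) (c : subvs_of h).

(** Stated for an arbitrary [alpha] and not only for simple roots, so that
    negating everything exchanges raising and lowering. *)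
Definition root_triple alpha c (e f : g) : Prop :=
  [/\ root_vector alpha e, root_vector (- alpha) f,
      vsval c = lie_bracket e f & alpha c = 2%:R].

Lemma root_triple_opp alpha c e f :
  root_triple alpha c e f -> root_triple (- alpha) (- c) f e.
Proof.
case=> he hf hc a2; split; rewrite ?opprK //.
  by rewrite linearN /= hc lie_skew opprK.
by rewrite opp_lfunE linearN opprK.
Qed.

Lemma root_triple_sl2 V alpha c e f :
  root_triple alpha c e f ->
  sl2_triple (act_lfun V e) (act_lfun V f) (act_lfun V (vsval c)).
Proof.
case=> he hf hc a2; split=> v; rewrite !act_lfunE.
- by rewrite hc mod_bracket addrC subrK.
- have := mod_bracket (vsval c) e v; rewrite he a2 mod_actZl => ->.
  by rewrite addrC subrK.
- have := mod_bracket (vsval c) f v; rewrite hf opp_lfunE a2 mod_actZl scaleNr.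
  by move/eqP; rewrite eq_sym subr_eq addrC => /eqP.
Qed.

Definition weight_vector V mu (v : V) : Prop :=
  forall x : subvs_of h, mod_act (vsval x) v = mu x *: v.

Lemma weight_vector_act V mu alpha e (v : V) k :
  root_vector alpha e -> weight_vector mu v ->
  weight_vector (mu + alpha *+ k) (iter k (act_lfun V e) v).
Proof.
move=> he hv; elim: k => [|k IHk] x /=; first by rewrite mulr0n addr0 hv.
have := mod_bracket (vsval x) e (iter k (act_lfun V e) v).
rewrite he mod_actZl IHk => /eqP; rewrite eq_sym subr_eq addrC act_lfunE => /eqP->.
rewrite -!act_lfunE linearZ /= -scalerDl mulrSr addrA [in RHS]add_lfunE.
by rewrite addrC.
Qed.

Lemma weight_string_down V alpha c e f mu :
  root_triple alpha c e f -> is_weight V mu ->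
  exists m : int, mu c = m%:~R /\
    forall j : nat, j%:Z <= m -> is_weight V (mu - alpha *+ j).
Proof.
move=> tri [v v0 hv]; have [he hf _ _] := tri.
have hc : act_lfun V (vsval c) v = mu c *: v by rewrite act_lfunE hv.
have [p [N [mN fN]]] := sl2_string (root_triple_sl2 V tri) v0 hc.
exists (N%:Z - p%:Z *+ 2); split.
  by rewrite mN rmorphB /= rmorphMn /= !pmulrn mulr_natl pmulrn.
(* Lowering the highest vector p + j times stays within the string: this is
   where j <= N - 2p is used. *)
move=> j jm; exists (iter (p + j) (act_lfun V f) (iter p (act_lfun V e) v)).
  by apply: fN; lia.
have := weight_vector_act (p + j) hf (weight_vector_act p he hv).
by rewrite mulNrn mulrnDr opprD addrA addrK.
Qed.

(** The upper half of the string is the lower half for the opposite triple. *)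
Lemma weight_string V alpha c e f mu :
  root_triple alpha c e f -> is_weight V mu ->
  exists m : int, [/\ mu c = m%:~R,
    forall j : nat, j%:Z <= m -> is_weight V (mu - alpha *+ j) &
    forall j : nat, j%:Z <= - m -> is_weight V (mu + alpha *+ j)].
Proof.
move=> tri wmu; have [m [muc down]] := weight_string_down tri wmu.
have [m' [muc' up]] := weight_string_down (root_triple_opp tri) wmu.
have eq_m' : m' = - m.
  by apply/eqP; rewrite -(eqr_int F) -muc' linearN /= muc rmorphN.
exists m; split=> // j; rewrite -eq_m' => /up.
by rewrite mulNrn opprK.
Qed.

Lemma highest_weight_nat V alpha c e f mu :
  root_triple alpha c e f -> is_weight V mu -> ~ is_weight V (mu + alpha) ->
  exists m : nat, mu c = m%:R.
Proof.
move=> tri wmu nomu; have [m [muc _ up]] := weight_string tri wmu.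
have m0 : 0 <= m.
  rewrite leNgt; apply/negP => m0; apply: nomu.
  by have := up 1%N; rewrite mulr1n; apply; lia.
by exists `|m|%N; rewrite muc natr_absz ger0_norm.
Qed.

End Weights.
End LieModules.

Arguments adjoint {F} g.

(** * Cartan integers and minuscule weights *)

Section SimpleRoots.
Local Open Scope ring_scope.
Context {F : numFieldType} {g : lieAlgebra F} {h : {vspace g}} {n : nat}.
Variable D : simpleRoots h n.
Implicit Types (mu nu alpha beta : cartan_dual h) (i j : 'I_n) (a : seq 'I_n).

Local Notation root i := (simple_root D i).
Local Notation coroot i := (simple_coroot D i).

Definition root_coef j mu : F := coord [tuple root i | i < n] j mu.

Lemma root_coefD j mu nu : root_coef j (mu + nu) = root_coef j mu + root_coef j nu.
Proof. exact: linearD. Qed.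

Lemma root_coefN j mu : root_coef j (- mu) = - root_coef j mu.
Proof. exact: linearN. Qed.

Lemma root_coefZ j x mu : root_coef j (x *: mu) = x * root_coef j mu.
Proof. exact: linearZ. Qed.

Lemma root_coefMn j mu k : root_coef j (mu *+ k) = root_coef j mu *+ k.
Proof. exact: linearMn. Qed.

Lemma root_coef_root i j : root_coef j (root i) = (i == j)%:R.
Proof.
have free_roots := basis_free (simple_root_basis D).
rewrite /root_coef -(coord_free i j free_roots) -tnth_nth tnth_mktuple.
by [].
Qed.

Lemma root_coef_eq0 mu : (forall j, root_coef j mu = 0) -> mu = 0.
Proof.
move=> coef0; rewrite (coord_basis (simple_root_basis D) (memvf mu)) big1 // => j _.
by rewrite [coord _ _ _]coef0 scale0r.
Qed.

Lemma root_coef_sum j (k : 'I_n -> nat) :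
  root_coef j (\sum_i root i *+ k i) = (k j)%:R.
Proof.
rewrite [LHS]linear_sum (bigD1 j) //= big1 => [|i ij].
  by rewrite addr0 [LHS]root_coefMn root_coef_root eqxx.
by rewrite [LHS]root_coefMn root_coef_root (negPf ij) mul0rn.
Qed.

(** Its coordinates on the simple roots, 1 and -1, have opposite signs. *)
Lemma difference_not_root i j : i != j -> ~ is_root (root j - root i).
Proof.
move=> ij /(simple_root_sign D)[k eq_k].
have coefE l : root_coef l (root j - root i) = (j == l)%:R - (i == l)%:R.
  by rewrite root_coefD root_coefN !root_coef_root.
have := coefE i; have := coefE j; rewrite !eqxx (negPf ij) eq_sym (negPf ij).
have nat_neqN1 (m : nat) : - 1 = m%:R :> F -> False.
  by move/eqP; rewrite eq_sym -subr_eq0 opprK natr1 pnatr_eq0.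
case: eq_k => ->; first by rewrite !root_coef_sum sub0r => _ /esym/nat_neqN1.
by rewrite !root_coefN !root_coef_sum subr0 => /(canRL opprK)/esym/nat_neqN1.
Qed.

Lemma simple_root_triple i : exists e f, root_triple (root i) (coroot i) e f.
Proof.
have [e [f [he hf hc]]] := simple_corootP D i.
by exists e, f; split=> //; apply: simple_coroot2.
Qed.

Lemma simple_root_neq0 i : root i != 0.
Proof. by have [] := simple_root_is_root D i. Qed.

Lemma adjoint_weightP alpha : alpha != 0 -> is_weight (adjoint g) alpha <-> is_root alpha.
Proof. by move=> a0; split=> [[v v0 hv] | [_ [v v0 hv]]]; [split=> //|]; exists v. Qed.

Lemma difference_not_weight i j : i != j -> ~ is_weight (adjoint g) (root j - root i).
Proof.
move=> ij /adjoint_weightP H; apply: (difference_not_root ij); apply: H.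
rewrite subr_eq0; apply/eqP => /(congr1 (root_coef j)); rewrite !root_coef_root eqxx.
by rewrite (negPf ij) => /eqP; rewrite oner_eq0.
Qed.

Lemma simple_root_weight i : is_weight (adjoint g) (root i).
Proof. by apply/adjoint_weightP/simple_root_is_root; apply: simple_root_neq0. Qed.

(** In the adjoint module a root vector for [root j] is a lowest weight vector
    for the sl2 of [root i], since [root j - root i] is not a root. *)
Lemma cartan_integer i j : i != j -> exists c : nat, root j (coroot i) = - c%:R.
Proof.
move=> ij; have [e [f tri]] := simple_root_triple i.
have [c] : exists c : nat, root j (- coroot i) = c%:R.
  apply: highest_weight_nat (root_triple_opp tri) (simple_root_weight j) _.
  exact: difference_not_weight.
by rewrite linearN /= => cE; exists c; rewrite -cE opprK.
Qed.

(** Otherwise [root i + root j] is a root, of value 2 on the coroot of [i]; its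
    string would then reach [root j - root i]. *)
Lemma cartan_integer_eq0 i j : i != j -> root j (coroot i) = 0 -> root i (coroot j) = 0.
Proof.
move=> ij aij0; have ji : j != i by rewrite eq_sym.
have [c aji] := cartan_integer ji; case: c aji => [-> | c aji]; first by rewrite oppr0.
have [ei [fi trii]] := simple_root_triple i.
have [ej [fj trij]] := simple_root_triple j.
have [m [muc _ up]] := weight_string trij (simple_root_weight i).
have m_neg : m = - c.+1%:Z.
  by apply/eqP; rewrite -(eqr_int F) -muc aji rmorphN /= -pmulrn.
have w_sum : is_weight (adjoint g) (root i + root j).
  by have := up 1%N; rewrite mulr1n; apply; lia.
have [m' [muc' down _]] := weight_string trii w_sum.
have m'2 : m' = 2.
  apply/eqP; rewrite -(eqr_int F) -muc' add_lfunE aij0 (simple_coroot2 D).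
  by rewrite addr0.
case: (difference_not_weight ij); have := down 2; rewrite mulr2n opprD addrA.
by rewrite [root i + root j]addrC addrK; apply; rewrite m'2.
Qed.

Lemma root_le_coef mu nu j : root_le D mu nu -> root_coef j mu <= root_coef j nu.
Proof.
elim=> {mu nu} [mu nu [i eq_i] | mu | mu nu eta _ le1 _ le2] //; last exact: le_trans le2.
by rewrite -subr_ge0 -root_coefN -root_coefD eq_i root_coef_root ler0n.
Qed.

Lemma simple_reflectionK i : involutive (simple_reflection D i).
Proof.
move=> mu; rewrite !simple_reflectionE /reflection_fun.
set m : F := mu (coroot i).
have -> : ((mu - m *: root i) (coroot i) : F) = - m.
  rewrite add_lfunE opp_lfunE scale_lfunE (simple_coroot2 D) -/m.
  by rewrite -[m *: _]/(m * 2%:R); ring.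
by rewrite scaleNr opprK subrK.
Qed.

Lemma word_prod_rcons a i :
  word_prod D (rcons a i) = (word_prod D a \o simple_reflection D i)%VF.
Proof.
by elim: a => [|j a IHa] /=; rewrite ?comp_lfun1r ?comp_lfun1l // IHa comp_lfunA.
Qed.

Lemma word_prod_revK a : (word_prod D (rev a) \o word_prod D a = \1)%VF.
Proof.
apply/lfunP => mu; rewrite comp_lfunE id_lfunE; elim: a mu => [|i a IHa] mu.
  by rewrite /= !id_lfunE.
by rewrite rev_cons word_prod_rcons /= !comp_lfunE simple_reflectionK IHa.
Qed.

Lemma is_weight_reflection (V : lieModule g) mu i :
  is_weight V mu -> is_weight V (simple_reflection D i mu).
Proof.
move=> wmu; rewrite simple_reflectionE /reflection_fun.
have [e [f tri]] := simple_root_triple i.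
have [m [muc down up]] := weight_string tri wmu.
rewrite muc scaler_int; have [m0 | m0] := lerP 0 m.
  by have := down `|m|%N; rewrite pmulrn gez0_abs //; apply.
have <- : mu + root i *+ `|m|%N = mu - root i *~ m.
  by rewrite pmulrn ltz0_abs // mulrNz.
by apply: up; lia.
Qed.

Lemma is_weight_word (V : lieModule g) mu a :
  is_weight V mu -> is_weight V (word_prod D a mu).
Proof.
elim: a => [|i a IHa] wmu /=; first by rewrite id_lfunE.
by rewrite comp_lfunE; apply/is_weight_reflection/IHa.
Qed.

Section Minuscule.
Variables (V : lieModule g) (lambda : cartan_dual h).
Hypotheses (minV : minuscule_module D V) (highV : highest_weight D V lambda).

(** Let [w] move [mu - alpha] to the highest weight.  Then [w mu] and
    [w (mu - (m + 2) alpha)] are weights on opposite sides of the highest weight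
    along the line of [w alpha], although both lie below it. *)
Lemma no_inner_weight mu alpha (m : nat) :
  is_weight V mu -> is_weight V (mu - alpha) -> is_weight V (mu - alpha *+ m.+2) ->
  alpha = 0.
Proof.
move=> w0 w1 w2; have [_ _ trans] := minV; have [wl highest] := highV.
have [_ [a _ <-] wlam] := trans _ _ w1 wl.
set w := word_prod D a in wlam; pose beta := w alpha.
have wmu : w mu = lambda + beta by rewrite -wlam linearB /= subrK.
have w2E : w (mu - alpha *+ m.+2) = lambda - beta *+ m.+1.
  by rewrite linearB linearMn /= wmu mulrS opprD addrA addrK.
have le0 j : root_coef j (w mu) <= root_coef j lambda.
  by apply/root_le_coef/highest/is_weight_word.
have le2 j : root_coef j (w (mu - alpha *+ m.+2)) <= root_coef j lambda.
  by apply/root_le_coef/highest/is_weight_word.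
have beta0 : beta = 0.
  apply: root_coef_eq0 => j; apply/eqP; rewrite eq_le; apply/andP; split.
    by have := le0 j; rewrite wmu root_coefD gerDl.
  have := le2 j; rewrite w2E root_coefD root_coefN root_coefMn gerDl oppr_le0.
  by rewrite pmulrn_lge0.
by rewrite -[alpha]id_lfunE -(word_prod_revK a) comp_lfunE -/w -/beta beta0 linear0.
Qed.

Lemma minuscule_weight_value mu i : is_weight V mu ->
  [\/ mu (coroot i) = 1, mu (coroot i) = 0 | mu (coroot i) = -1].
Proof.
move=> wmu; have [e [f tri]] := simple_root_triple i.
have [m [muc down up]] := weight_string tri wmu.
have m_le1 : m <= 1.
  rewrite leNgt; apply: contra_neqN (simple_root_neq0 i) => m1.
  apply: (@no_inner_weight mu _ `|m|.-2) => //.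
    by have := down 1%N; rewrite mulr1n; apply; lia.
  by apply: down; lia.
have m_geN1 : -1 <= m.
  rewrite leNgt; apply: contra_neqN (simple_root_neq0 i) => m1.
  apply: oppr_inj; rewrite oppr0.
  apply: (@no_inner_weight mu _ `|m|.-2) => //.
    by have := up 1%N; rewrite mulr1n opprK; apply; lia.
  by rewrite mulNrn opprK; apply: up; lia.
rewrite muc; have : m = 1 \/ m = 0 \/ m = -1 by lia.
by case=> [-> | [-> | ->]]; [constructor 1 | constructor 2 | constructor 3].
Qed.

End Minuscule.
End SimpleRoots.

(** * Descending words *)

Section NumbersGame.
Local Open Scope ring_scope.
Context {F : numFieldType} {g : lieAlgebra F} {h : {vspace g}} {n : nat}.
Variable D : simpleRoots h n.
Implicit Types (mu nu : cartan_dual h) (i j : 'I_n) (a d : seq 'I_n).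

Local Notation root i := (simple_root D i).
Local Notation refl i := (simple_reflection D i).

Definition pairing mu i : F := mu (simple_coroot D i).

Lemma pairingD mu nu i : pairing (mu + nu) i = pairing mu i + pairing nu i.
Proof. by rewrite /pairing add_lfunE. Qed.

Lemma pairingN mu i : pairing (- mu) i = - pairing mu i.
Proof. by rewrite /pairing opp_lfunE. Qed.

Lemma pairingZ x mu i : pairing (x *: mu) i = x * pairing mu i.
Proof. by rewrite /pairing scale_lfunE. Qed.

Definition pairingE := (pairingD, pairingN, pairingZ).

Lemma pairing_root i : pairing (root i) i = 2%:R.
Proof. exact: simple_coroot2. Qed.

Lemma reflE i mu : refl i mu = mu - pairing mu i *: root i.
Proof. exact: simple_reflectionE. Qed.

Variable c : 'I_n -> 'I_n -> nat.
Hypothesis c_diag : forall i, c i i = 0%N.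
Hypothesis cE : forall i j, i != j -> pairing (root j) i = - (c i j)%:R.
Hypothesis c_sym0 : forall i j, (c i j == 0%N) = (c j i == 0%N).

Section RankTwo.
Variables (i j : 'I_n) (mu : cartan_dual h).
Hypothesis ij : i != j.

(** Reflections in the rank-two subsystem act on these combinations by explicit
    formulas on the two coefficients, which reduces the braid relations to
    polynomial identities. *)
Definition rank2_combination (x y : F) := mu + x *: root i + y *: root j.

Lemma refl_rank2l x y :
  refl i (rank2_combination x y) =
    rank2_combination (y * (c i j)%:R - x - pairing mu i) y.
Proof.
rewrite reflE /rank2_combination !pairingE pairing_root (cE ij).
rewrite addrAC -[_ - _ *: _]addrA -scalerBl; congr (_ + _ *: _ + _); ring.
Qed.

Lemma refl_rank2r x y :
  refl j (rank2_combination x y) =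
    rank2_combination x (x * (c j i)%:R - y - pairing mu j).
Proof.
rewrite reflE /rank2_combination !pairingE pairing_root cE 1?eq_sym //.
rewrite -addrA -scalerBl; congr (_ + _ *: _); ring.
Qed.

Lemma rank2_combination0 : rank2_combination 0 0 = mu.
Proof. by rewrite /rank2_combination !scale0r !addr0. Qed.

End RankTwo.

Lemma refl_commute i j mu : c i j = 0%N -> refl i (refl j mu) = refl j (refl i mu).
Proof.
have [-> // | ij] := eqVneq i j; move=> cij.
have cji : c j i = 0%N by apply/eqP; rewrite -c_sym0 cij.
rewrite -{1 2}(rank2_combination0 i j mu) !(refl_rank2l, refl_rank2r) // cij cji.
by congr (rank2_combination _ _ _ _ _); ring.
Qed.

Lemma refl_braid3 i j mu : c i j = 1%N -> c j i = 1%N ->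
  refl i (refl j (refl i mu)) = refl j (refl i (refl j mu)).
Proof.
have [-> // | ij] := eqVneq i j; move=> cij cji.
rewrite -{1 2}(rank2_combination0 i j mu) !(refl_rank2l, refl_rank2r) // cij cji.
by congr (rank2_combination _ _ _ _ _); ring.
Qed.

Lemma refl_braid4 i j mu : c i j = 1%N -> c j i = 2%N ->
  refl i (refl j (refl i (refl j mu))) = refl j (refl i (refl j (refl i mu))).
Proof.
have [-> // | ij] := eqVneq i j; move=> cij cji.
rewrite -{1 2}(rank2_combination0 i j mu) !(refl_rank2l, refl_rank2r) // cij cji.
by congr (rank2_combination _ _ _ _ _); ring.
Qed.

Lemma weyl_commuteE i j : weyl_commute D i j = (c i j == 0%N).
Proof.
apply/eqP/eqP => [comm | cij]; last first.
  by apply/lfunP => mu; rewrite !comp_lfunE refl_commute.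
have [-> // | ij] := eqVneq i j.
(* The two products send [root j] to vectors whose coordinates at [root i] are
   opposite to each other, equal to [c i j] up to sign. *)
have := congr1 (fun w : 'End(_) => root_coef D i (w (root j))) comm.
rewrite !comp_lfunE -(rank2_combination0 i j (root j)) !(refl_rank2l, refl_rank2r) //.
rewrite /rank2_combination !root_coefD !root_coefZ !root_coef_root eqxx.
rewrite [j == i]eq_sym (negPf ij) !pairing_root (cE ij) => /eqP; rewrite -subr_eq0 /=.
rewrite (_ : _ - _ = - (2 * c i j)%N%:R) => [|]; last by rewrite natrM; ring.
by rewrite oppr_eq0 pnatr_eq0 muln_eq0 => /eqP.
Qed.

Variable lambda : cartan_dual h.
Local Notation wt d := (word_prod D d lambda).

Lemma wt_cons i d : wt (i :: d) = refl i (wt d).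
Proof. by rewrite /= comp_lfunE. Qed.

(** Read from right to left, each letter of [d] lowers the current weight by
    exactly one simple root. *)
Fixpoint descending d : bool :=
  if d is i :: d' then descending d' && (pairing (wt d') i == 1) else true.

Lemma descending_consP i d :
  reflect (descending d /\ pairing (wt d) i = 1) (descending (i :: d)).
Proof. by apply: (iffP andP) => -[desc /eqP]. Qed.

Lemma wt_descending i d : pairing (wt d) i = 1 -> wt (i :: d) = wt d - root i.
Proof. by rewrite wt_cons reflE => ->; rewrite scale1r. Qed.

Hypothesis dominant : forall i, exists k : nat, pairing lambda i = k%:R.
Hypothesis values : forall d i, descending d ->
  [\/ pairing (wt d) i = 1, pairing (wt d) i = 0 | pairing (wt d) i = -1].

(** This is how [values] is exploited: it bounds the Cartan integers that can
    occur next to a given weight. *)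
Lemma value_nat d i (k : nat) : descending d -> pairing (wt d) i = 1 - k%:R -> (k <= 2)%N.
Proof.
move=> /values-/(_ i) val eqk.
have {}eqk : k%:R = 1 - pairing (wt d) i by rewrite eqk opprB addrC subrK.
case: val eqk => -> /eqP; rewrite ?subrr ?subr0 ?opprK ?pnatr_eq0.
- by move=> /eqP->.
- by rewrite (eqr_nat F k 1) => /eqP->.
by rewrite (eqr_nat F k 2) => /eqP->.
Qed.

(** If the last step of [d] was made by another letter [j], the coordinate at
    [i] before that step was [-1 - c i j]; as it is at least -1, the letters
    [i] and [j] commute and the induction hypothesis applies one step earlier. *)
Lemma descending_up d i :
  descending d -> pairing (wt d) i = -1 ->
  exists d', [/\ descending (i :: d'), word_prod D (i :: d') = word_prod D d &
                 (size d').+1 = size d].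
Proof.
elim: d => [_ | j d IHd /descending_consP[desc dj]].
  have [k] := dominant i; rewrite /= id_lfunE => -> /eqP.
  by rewrite -subr_eq0 opprK natr1 pnatr_eq0.
have [<- _ | ij] := eqVneq j i.
  by exists d; split=> //; apply/descending_consP.
rewrite (wt_descending dj) !pairingE cE 1?eq_sym // opprK => di.
have {}di : pairing (wt d) i = 1 - (c i j).+2%:R.
  by rewrite -[pairing _ _](addrK (c i j)%:R) di -!natr1; ring.
have /eqP cij : c i j == 0%N by have := value_nat desc di; rewrite !ltnS leqn0.
have cji : c j i = 0%N by apply/eqP; rewrite -c_sym0 cij.
have [|d' [/descending_consP[desc' d'i] wp_d' sz]] := IHd desc.
  by rewrite di cij; ring.
have wt_d : wt d = wt d' - root i by rewrite -wp_d' (wt_descending d'i).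
have d'j : pairing (wt d') j = 1.
  by move: dj; rewrite wt_d !pairingE cE // cji => <-; ring.
exists (j :: d'); split; [ | | by rewrite /= sz].
  apply/descending_consP; rewrite (wt_descending d'j); split.
    exact/descending_consP.
  by rewrite !pairingE cE 1?eq_sym // cij d'i; ring.
apply/lfunP => mu; rewrite /= !comp_lfunE refl_commute //; congr (refl j _).
by rewrite -wp_d' /= comp_lfunE.
Qed.

(** Undo the last steps of [d] in the letters [i] and [j] until one of the
    coordinates at [i] and [j] is again 0.  The values in {-1, 0, 1} leave only
    the cases where [c i j] and [c j i] are 0 and 0, 1 and 1, or 1 and 2, and the
    braid relation of that case carries the reflection past the steps undone. *)
Lemma descending_fix d i :
  descending d -> pairing (wt d) i = 0 ->
  exists2 j, stabilizer_set D lambda j &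
    forall mu, refl i (word_prod D d mu) = word_prod D d (refl j mu).
Proof.
have [m] := ubnP (size d); elim: m d i => // m IHm [|j d] i.
  move=> _ _; rewrite /= id_lfunE => li; exists i => [|mu]; last by rewrite !id_lfunE.
  by rewrite /stabilizer_set reflE li scale0r subr0.
rewrite ltnS => /= szd /descending_consP[desc dj].
rewrite -[(_ \o _)%VF _]/(wt (j :: d)) (wt_descending dj).
have [-> /eqP | ij] := eqVneq i j.
  by rewrite !pairingE pairing_root dj subr_eq0 (eqr_nat F 1 2).
have ji : j != i by rewrite eq_sym.
rewrite !pairingE cE // opprK => di.
have {}di : pairing (wt d) i = - (c i j)%:R by apply/eqP; rewrite -addr_eq0 di.
have [cij | cij_pos] := posnP (c i j).
  have [|k kJ IH] := IHm d i szd desc; first by rewrite di cij oppr0.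
  by exists k => // mu; rewrite !comp_lfunE refl_commute // IH.
have cij : c i j = 1%N.
  have := @value_nat d i (c i j).+1 desc.
  rewrite di -natr1 opprD addrA addrAC subrr add0r.
  by move=> /(_ erefl); lia.
have cji_pos : (0 < c j i)%N by rewrite lt0n -c_sym0 -lt0n cij_pos.
have [|d1 [/descending_consP[desc1 d1i] wp_d sz1]] := descending_up (i := i) desc.
  by rewrite di cij.
have wt_d : wt d = wt d1 - root i by rewrite -wp_d (wt_descending d1i).
have d1j : pairing (wt d1) j = 1 - (c j i)%:R.
  by move: dj; rewrite wt_d !pairingE (cE ji) opprK => /(canRL (addrK _)).
have wp_dE mu : word_prod D d mu = refl i (word_prod D d1 mu).
  by rewrite -wp_d /= comp_lfunE.
have := value_nat desc1 d1j; rewrite leq_eqVlt => /orP[/eqP cji | cji].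
  have [|d2 [/descending_consP[desc2 d2j] wp_d1 sz2]] := descending_up (i := j) desc1.
    by rewrite d1j cji; ring.
  have wt_d1 : wt d1 = wt d2 - root j by rewrite -wp_d1 (wt_descending d2j).
  have d2i : pairing (wt d2) i = 0.
    move: d1i; rewrite wt_d1 !pairingE cE // cij opprK => /(canRL (addrK _)).
    by rewrite subrr.
  have [|k kJ IH] := IHm d2 i _ desc2 d2i; first by lia.
  exists k => // mu; have wp_d1E nu : word_prod D d1 nu = refl j (word_prod D d2 nu).
    by rewrite -wp_d1 /= comp_lfunE.
  by rewrite !comp_lfunE !wp_dE !wp_d1E refl_braid4 // IH.
have {cji cji_pos}cji : c j i = 1%N by lia.
have szd1 : (size d1 < m)%N by lia.
have [|k kJ IH] := IHm d1 j szd1 desc1; first by rewrite d1j cji subrr.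
by exists k => // mu; rewrite !comp_lfunE !wp_dE refl_braid3 // IH.
Qed.

Lemma word_stabilizer v : all (stabilizer_set D lambda) v -> wt v = lambda.
Proof.
elim: v => [|i v IHv] /=; first by rewrite id_lfunE.
by case/andP=> /eqP iJ /IHv vJ; rewrite comp_lfunE vJ.
Qed.

(** A letter put in front of [d v] extends [d] when its coordinate is 1, cancels
    against [d] when it is -1, and passes through [d] to join [v] when it is 0.
    The length is kept only if the coordinate is 1 at each step. *)
Lemma descending_decomposition b :
  exists d v, [/\ descending d, all (stabilizer_set D lambda) v,
    word_prod D b = (word_prod D d \o word_prod D v)%VF,
    (size d <= size b)%N & size d = size b -> descending b].
Proof.
elim: b => [|i b [d [v [desc vJ wp_b szd descb]]]].
  by exists [::], [::]; split; rewrite //= comp_lfun1l.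
have wt_b : wt b = wt d by rewrite wp_b comp_lfunE word_stabilizer.
have [di | di | di] := values i desc.
- exists (i :: d), v; split => //=; first exact/descending_consP.
    by rewrite wp_b comp_lfunA.
  by move=> [/descb descb']; apply/descending_consP; rewrite wt_b.
- have [j jJ fix_d] := descending_fix desc di.
  exists d, (j :: v); split; rewrite //= ?vJ ?andbT //; last 2 first.
  + exact: leqW.
  + by move=> szE; move: szd; rewrite szE ltnn.
  by rewrite wp_b; apply/lfunP => mu; rewrite !comp_lfunE fix_d.
have [d' [/descending_consP[desc' _] wp_d sz']] := descending_up desc di.
exists d', v; split => //=; last 2 first.
- by rewrite -sz' in szd; lia.
- by rewrite -sz' in szd; lia.
rewrite wp_b -wp_d; apply/lfunP => mu.
by rewrite /= !comp_lfunE simple_reflectionK.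
Qed.

Lemma weyl_length_le a : (weyl_length D (word_prod D a) <= size a)%N.
Proof.
rewrite /weyl_length; case: boolp.pselect => // wW; case: ex_minnP => k _; apply.
by apply/existsP; exists (in_tuple a).
Qed.

(** Write [a = d v] as above.  Then [d] lies in the coset of [w], so minimality
    gives [size a <= size d]. *)
Lemma reduced_min_coset_descending w a :
  min_coset_rep D (stabilizer_set D lambda) w -> reduced_word D w a -> descending a.
Proof.
move=> [_ minw] [wE sz]; have [d [v [desc vJ wp_a szd]]] := descending_decomposition a.
apply; apply/eqP; rewrite eqn_leq szd sz.
have := minw (word_prod D (rev v)); rewrite -wE wp_a -comp_lfunA.
have := word_prod_revK D (rev v); rewrite revK => ->; rewrite comp_lfun1r.
move=> minv; apply: leq_trans (weyl_length_le d).
by apply: minv; exists (rev v); rewrite ?all_rev.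
Qed.

End NumbersGame.

(** * The heap of a minuscule module *)

Section MinusculeHeap.
Local Open Scope ring_scope.
Context {F : numFieldType} {g : lieAlgebra F} {h : {vspace g}} {n : nat}.
Variables (D : simpleRoots h n) (V : lieModule g) (lambda : cartan_dual h).

Lemma highest_weight_dominant i :
  highest_weight D V lambda -> exists k : nat, pairing D lambda i = k%:R.
Proof.
case=> wl highest; have [e [f tri]] := simple_root_triple D i.
apply: highest_weight_nat tri wl _ => /highest/(root_le_coef i).
by rewrite root_coefD root_coef_root eqxx gerDl lern0.
Qed.

Lemma cartan_matrix_exists : exists c : 'I_n -> 'I_n -> nat,
  [/\ forall i, c i i = 0%N,
      forall i j, i != j -> pairing D (simple_root D j) i = - (c i j)%:R &
      forall i j, (c i j == 0%N) = (c j i == 0%N)].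
Proof.
pose R i j (k : nat) := (i == j -> k = 0%N) /\
  (i != j -> pairing D (simple_root D j) i = - k%:R).
have ex i j : exists k, R i j k.
  rewrite /R; have [_ | ij] := eqVneq i j; first by exists 0%N.
  by have [c cij] := cartan_integer D ij; exists c.
have [c Hc] := fin_all_exists (fun i => fin_all_exists (ex i)).
exists c; split=> [i | i j ij | ].
- by have [-> ] := Hc i i.
- by have [_ ->] := Hc i j.
have imp i j : c i j = 0%N -> c j i = 0%N.
  move=> cij; have [[_ cE] [c0 cE']] := (Hc i j, Hc j i).
  have [-> | ji] := eqVneq j i; first by have [-> ] := Hc i i.
  have /cE : i != j by rewrite eq_sym.
  rewrite cij oppr0 => /(cartan_integer_eq0 _); rewrite eq_sym => /(_ ji).
  rewrite -[LHS]/(pairing D _ _) cE' // => /eqP.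
  by rewrite oppr_eq0 pnatr_eq0 => /eqP.
by move=> i j; apply/eqP/eqP; apply: imp.
Qed.

Section Balance.
Variables (c : 'I_n -> 'I_n -> nat) (lam : 'I_n -> nat).
Hypothesis c_diag : forall i, c i i = 0%N.
Hypothesis cE :
  forall i j, i != j -> pairing D (simple_root D j) i = - (c i j)%:R.
Hypothesis lamE : forall i, pairing D lambda i = (lam i)%:R.

Lemma descending_weightE d : descending D lambda d ->
  word_prod D d lambda = lambda - \sum_(i <- d) simple_root D i.
Proof.
elim: d => [_ | i d IHd /descending_consP[desc di]].
  by rewrite big_nil subr0 id_lfunE.
by rewrite wt_descending // IHd // big_cons opprD addrCA addrC.
Qed.

(** The value 1 at the last step of the game, rewritten without subtraction so
    that it becomes an identity between natural numbers. *)
Lemma descending_balance i d : descending D lambda (i :: d) ->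
  (lam i + \sum_(j <- d) c i j = 1 + 2 * \sum_(j <- d) (j == i))%N.
Proof.
case/descending_consP=> desc /eqP; rewrite descending_weightE // pairingD pairingN.
have -> : pairing D (\sum_(j <- d) simple_root D j) i =
    \sum_(j <- d) pairing D (simple_root D j) i.
  elim: d {desc} => [|j d IHd]; last by rewrite !big_cons pairingD IHd.
  by rewrite !big_nil /pairing zero_lfunE.
rewrite lamE (eq_bigr (fun j => (2 * (j == i))%N%:R - (c i j)%:R)) => [|j _]; last first.
  have [-> | ji] := eqVneq j i; first by rewrite pairing_root c_diag subr0.
  by rewrite cE 1?eq_sym // sub0r.
rewrite sumrB opprB addrA -!natr_sum -natrD subr_eq -(natrD F 1) eqr_nat => /eqP.
by rewrite big_distrr.
Qed.
End Balance.

Lemma descending_suffix u d : descending D lambda (u ++ d) -> descending D lambda d.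
Proof. by elim: u => //= i u IHu /andP[/IHu]. Qed.

Lemma sum_drop l (a : l.-tuple 'I_n) m (G : 'I_n -> nat) :
  (\sum_(j <- drop m a) G j = \sum_(y < l | m <= y) G (tnth a y))%N.
Proof.
rewrite -{1}(map_tnth_enum a) -map_drop big_map big_uniq ?drop_uniq ?enum_uniq //=.
apply: eq_bigl => y; rewrite -(mem_map val_inj) map_drop val_enum_ord drop_iota.
rewrite mem_iota; have := ltn_ord y; rewrite /=; lia.
Qed.

Lemma heap_le_geq l (a : l.-tuple 'I_n) (x y : 'I_l) : heap_le D a x y -> (y <= x)%N.
Proof.
case/connectP=> s + ->; elim: s x => //= z s IHs x /andP[/andP[zx _] /IHs].
by move/leq_trans; apply; apply: ltnW.
Qed.

Theorem minuscule_heap_conjugate (disp : Order.disp_t) (P : finPOrderType disp)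
    (label : P -> 'I_n) (sigma : 'S_n) :
  minuscule_module D V -> highest_weight D V lambda -> heap_labeling D lambda label ->
  exists2 t : {perm ideals P}, t \in toggle_group P &
    fon_der_flaass = (toggle_sequence label sigma ^ t)%g.
Proof.
move=> minV highV [w [l [a [f [[minw _] red [fi fK fiK] le_f label_f]]]]].
have [c [c_diag cE c_sym0]] := cartan_matrix_exists.
have [lam lamE] := fin_all_exists (fun i => highest_weight_dominant i highV).
have desc_a : descending D lambda a.
  apply: (reduced_min_coset_descending cE c_sym0 _ _ minw red).
    by move=> i; exists (lam i).
  move=> d i desc; apply: (minuscule_weight_value minV highV).
  by apply: is_weight_word; case: highV.
have linkE i j : ~~ weyl_commute D i j = (c i j != 0%N).
  by rewrite (weyl_commuteE c_diag cE c_sym0).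
have labelE p : label p = tnth a (fi p) by rewrite -label_f fiK.
(* Words act from right to left, so the letters are fired in the order opposite
   to their positions. *)
pose time p : nat := rev_ord (fi p).
have time_lt p q : (time p < time q)%N = (fi q < fi p)%N.
  by have := ltn_ord (fi p); have := ltn_ord (fi q); rewrite /time /=; lia.
have time_inj : injective time.
  by move=> p q /val_inj/rev_ord_inj/(can_inj fiK).
apply: (heap_conjugate (time := time) (c := c) (lam := lam)) => //.
- move=> p q pq; rewrite time_lt ltn_neqAle; apply/andP; split.
    by apply: contraTneq pq => /val_inj/(can_inj fiK)->; rewrite ltxx.
  by apply: (@heap_le_geq _ a); rewrite le_f !fiK ltW.
- move=> p q /coversP[pq no_between].
  have : heap_le D a (fi p) (fi q) by rewrite le_f !fiK ltW.
  case/connectP=> -[|z s] /=.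
    by move=> _ /(can_inj fiK) qp; rewrite qp ltxx in pq.
  case/andP=> /andP[zp link] path_s q_last.
  have pz : (p < f z)%O.
    rewrite lt_neqAle; apply/andP; split.
      by apply: contraTneq zp => ->; rewrite fK ltnn.
    by rewrite -[p]fiK -le_f; apply: connect1; rewrite zp link.
  have zq : (f z <= q)%O.
    by rewrite -[q]fiK -le_f; apply/connectP; exists s.
  have [zq' | zq'] := eqVneq (f z) q; last first.
    by case: (no_between (f z)); rewrite // lt_neqAle zq'.
  by rewrite !labelE -zq' fK -linkE.
- move=> p q link; rewrite time_lt => qp.
  rewrite lt_neqAle; apply/andP; split; first by apply: contraTneq qp => ->; rewrite ltnn.
  by rewrite -[p]fiK -[q]fiK -le_f; apply: connect1; rewrite qp -!labelE linkE.
move=> x; have sumE (G : 'I_n -> nat) :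
    (\sum_(y | time y < time x) G (label y) = \sum_(j <- drop (fi x).+1 a) G j)%N.
  rewrite sum_drop (reindex f) /=; last exact/onW_bij/(Bijective fK fiK).
  by apply: eq_big => y; rewrite ?time_lt ?fK // label_f.
have := desc_a; rewrite -(cat_take_drop (fi x) a) => /descending_suffix.
rewrite (drop_nth (label x)) ?size_tuple // labelE -tnth_nth -labelE.
move/(descending_balance c_diag cE lamE); rewrite -!sumE => ->.
by rewrite cardsE -sum1_card [in RHS]big_mkcondr.
Qed.

End MinusculeHeap.

Theorem theorem1p3 (R : realType) (g : lieAlgebra R[i]) (h : {vspace g})
    (n : nat) (D : simpleRoots h n) (V : lieModule g) (lambda : cartan_dual h)
    (disp : Order.disp_t) (P : finPOrderType disp) (label : P -> 'I_n)
    (sigma : 'S_n) :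
  simple_lie g ->
  cartan_subalgebra h ->
  minuscule_module D V ->
  highest_weight D V lambda ->
  minuscule_poset D V P ->
  heap_labeling D lambda label ->
  exists2 t : {perm ideals P},
    t \in toggle_group P &
    fon_der_flaass = (toggle_sequence label sigma ^ t)%g.
Proof.
by move=> _ _ minV highV _ heap; apply: (minuscule_heap_conjugate sigma minV highV heap).
Qed.
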